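(* Let $\mathbb{E}[W^2]<\infty$, fix an integer $q\ge3$ and $0<B<\log(q-1)$, and assume that $\mathscr{F}_B$ satisfies the zero-crossing condition. Consider the annealed $q$-state Potts model with field $(B,0,\dots,0)$ on the rank-1 random graph, with weights satisfying the weight regularity condition with limiting weight $W$. Let $X_1=\frac1n\sum_{i=1}^n\mathbf{1}_{\{\sigma_i=1\}}$. Then, for every $\beta>0$ with $\beta\ne\beta_c(B)$, $$\lim_{n\to\infty}\mathbb{E}_{\mu_{n;\beta,B}}[X_1]=\frac{\partial\varphi(\beta,B)}{\partial B}= x_1^\star(\beta,B),$$ where, with $\boldsymbol{y}^\star(\beta,B)=(y_1^\star,\dots,y_q^\star)$ the optimizer of the variational problem for $\varphi(\beta,B)$ and $\beta'=\mathrm{e}^\beta-1$, $$x_1^\star(\beta,B)=\mathbb{E}\left[\frac{\mathrm{e}^{y_1^\star\frac{\beta'}{\mathbb{E}[W]}W+B}}{\mathrm{e}^{y_1^\star\frac{\beta'}{\mathbb{E}[W]}W+B}+\mathrm{e}^{y_2^\star\frac{\beta'}{\mathbb{E}[W]}W}+\cdots+\mathrm{e}^{y_q^\star\frac{\beta'}{\mathbb{E}[W]}W}}\right].$$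
   Context: Random graph: for each $n$, the vertices $i\in[n]$ have deterministic weights $w_i>0$ (possibly depending on $n$), $\ell_n=\sum_{i\in[n]}w_i$, and the edge indicators $(I_{i,j})_{1\le i<j\le n}$ are independent with $\mathbb{P}(I_{i,j}=1)=\frac{w_iw_j}{\ell_n+w_iw_j}$. Weight regularity condition: with $F_n(x)=\frac1n\sum_{i\in[n]}\mathbf{1}_{\{w_i\le x\}}$ and $W_n\sim F_n$, there is a random variable $W$ with $\mathbb{E}[W]>0$ such that $W_n\to W$ in distribution, and there exist $c>0,\tau>2$ with $1-F_n(w)\le c\,w^{-(\tau-1)}$ for all $w\ge1$ (and all $n$). Annealed Potts measure on $[q]^n$: $\mu_{n;\beta,B}(\boldsymbol{\sigma})=\mathbb{E}[\mathrm{e}^{H_n(\boldsymbol{\sigma})}]/\sum_{\boldsymbol{\sigma}'\in[q]^n}\mathbb{E}[\mathrm{e}^{H_n(\boldsymbol{\sigma}')}]$, where $H_n(\boldsymbol{\sigma})=\beta\sum_{1\le i<j\le n}I_{i,j}\mathbf{1}_{\{\sigma_i=\sigma_j\}}+B\sum_{i\in[n]}\mathbf{1}_{\{\sigma_i=1\}}$ and $\mathbb{E}$ is over the random graph; $\mathbb{E}_{\mu_{n;\beta,B}}$ denotes expectation with respect to this measure. The limiting annealed pressure is $\varphi(\beta,B)=\lim_n\frac1n\log\sum_{\boldsymbol{\sigma}}\mathbb{E}[\mathrm{e}^{H_n(\boldsymbol{\sigma})}]$, which equals the variational problem $$\sup_{\boldsymbol{y}\in\mathbb{R}^q}\Big\{\mathbb{E}\Big[\log\Big(\mathrm{e}^{\frac{\beta'}{\mathbb{E}[W]}y_1W+B}+\sum_{k=2}^q\mathrm{e}^{\frac{\beta'}{\mathbb{E}[W]}y_kW}\Big)\Big]-\frac{\beta'}{2\mathbb{E}[W]}\sum_{k=1}^qy_k^2\Big\}.$$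 Zero-crossing condition for $\mathscr{F}_B(t)=\mathbb{E}\big[\frac{W}{\mathbb{E}[W]}\frac{\mathrm{e}^{tW+B}-1}{\mathrm{e}^{tW+B}+q-1}\big]$, $t\ge0$: (a) there is a (unique) $t_*(B)>0$ with $\mathscr{F}_B''>0$ on $(0,t_*(B))$ and $\mathscr{F}_B''<0$ on $(t_*(B),\infty)$; (b) $\mathscr{F}_B'(t_*(B))>\mathscr{F}_B(t_*(B))/t_*(B)$. Critical value: under the stated hypotheses, $\beta_c(B)\in(0,\infty)$ is the unique $\beta>0$ for which the maximizer over $s\in[0,1]$ of $p_{\beta,B}(s)=\mathbb{E}[\log(\mathrm{e}^{\beta'Ws+B}+q-1)]-\frac{\beta'\mathbb{E}[W]}{2q}[(q-1)s^2+2s-1]$ is not unique. For $\beta\neq\beta_c(B)$ the optimizer $\boldsymbol{y}^\star(\beta,B)$ is unique. *)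

(* Defs.v *)
From HB Require Import structures.
From mathcomp Require Import all_boot all_order all_algebra.
From mathcomp Require Import all_classical all_reals all_analysis.

Set Implicit Arguments.
Unset Strict Implicit.
Unset Printing Implicit Defensive.

Import Order.TTheory GRing.Theory Num.Theory.
Import numFieldNormedType.Exports.

Local Open Scope classical_set_scope.
Local Open Scope ring_scope.

Definition mean (R : realType) (d : measure_display) (T : measurableType d)
  (P : probability T R) (X : T -> R) : R := fine 'E_P[X].

Section RandomGraph.
Context {R : realType}.

(* Mutual independence of the family (X e), e \in D. *)
Definition independent_on (d d' : measure_display) (T : measurableType d)
    (S : measurableType d') (P : probability T R) (E : finType) (D : {set E})
    (X : E -> T -> S) : Prop :=
  forall (J : {set E}) (A : E -> set S), J \subset D ->
    (forall e, measurable (A e)) ->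
    fine (P [set omega | forall e, e \in J -> A e (X e omega)]) =
    \prod_(e in J) fine (P (X e @^-1` A e)).

Definition total_weight (n : nat) (w : 'I_n -> R) : R := \sum_(i < n) w i.

(* Only the entries I i j with i < j are constrained (and used in the
   Hamiltonian below). *)
Definition rank1_graph (n : nat) (w : 'I_n -> R) (d : measure_display)
    (T : measurableType d) (P : probability T R)
    (I : 'I_n -> 'I_n -> {RV P >-> bool}) : Prop :=
  independent_on P [set e : 'I_n * 'I_n | (e.1 < e.2)%N]
    (fun e => I e.1 e.2 : T -> bool) /\
  forall i j : 'I_n, (i < j)%N ->
    P [set omega | I i j omega] =
    (w i * w j / (total_weight w + w i * w j))%:E.

Definition empirical_cdf (n : nat) (w : 'I_n -> R) (x : R) : R :=
  n%:R^-1 * \sum_(i < n) (w i <= x)%R%:R.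

(* Convergence in distribution: convergence of the distribution functions at
   every continuity point of the limit. *)
Definition weights_cvg_in_distribution (w : forall n : nat, 'I_n -> R)
    (d : measure_display) (T : measurableType d) (P : probability T R)
    (W : {RV P >-> R}) : Prop :=
  let F := fun x : R => fine (P [set omega | W omega <= x]) in
  forall x : R, {for x, continuous F} ->
    empirical_cdf (@w n) x @[n --> \oo] --> F x.

(* The tail bound is required for n >= 1 only: for n = 0 the distribution
   function F_n is not defined. *)
Definition weight_regularity (w : forall n : nat, 'I_n -> R)
    (d : measure_display) (T : measurableType d) (P : probability T R)
    (W : {RV P >-> R}) : Prop :=
  [/\ (0 < 'E_P[W])%E,
      weights_cvg_in_distribution w W &
      exists c tau : R, [/\ 0 < c, 2 < tau &
        forall (n : nat) (x : R), (0 < n)%N -> 1 <= x ->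
          1 - empirical_cdf (@w n) x <= c * x `^ (- (tau - 1))]].

End RandomGraph.

(* The spins take values in 'I_q; the colour 1 is the ordinal of value 0. *)
Definition spin1 (q : nat) (hq : (2 < q)%N) : 'I_q := Ordinal (ltnW (ltnW hq)).

Section AnnealedPotts.
Context {R : realType}.
Variables (q : nat) (k1 : 'I_q).

Definition hamiltonian (n : nat) (g : 'I_n -> 'I_n -> bool) (beta B : R)
    (sigma : {ffun 'I_n -> 'I_q}) : R :=
  beta * (\sum_(i < n) \sum_(j < n | (i < j)%N)
            (g i j)%:R * (sigma i == sigma j)%:R)
  + B * (\sum_(i < n) (sigma i == k1)%:R).

Section FixedSize.
Variables (n : nat) (d : measure_display) (T : measurableType d).
Variables (P : probability T R) (I : 'I_n -> 'I_n -> {RV P >-> bool}).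

Definition annealed_weight (beta B : R) (sigma : {ffun 'I_n -> 'I_q}) : R :=
  mean P (fun omega =>
    expR (hamiltonian (fun i j => I i j omega) beta B sigma)).

Definition annealed_partition (beta B : R) : R :=
  \sum_(sigma : {ffun 'I_n -> 'I_q}) annealed_weight beta B sigma.

Definition annealed_potts (beta B : R) (sigma : {ffun 'I_n -> 'I_q}) : R :=
  annealed_weight beta B sigma / annealed_partition beta B.

Definition potts_mean (beta B : R) (f : {ffun 'I_n -> 'I_q} -> R) : R :=
  \sum_(sigma : {ffun 'I_n -> 'I_q}) annealed_potts beta B sigma * f sigma.

Definition proportion1 (sigma : {ffun 'I_n -> 'I_q}) : R :=
  n%:R^-1 * \sum_(i < n) (sigma i == k1)%:R.

End FixedSize.

Definition annealed_pressure (d : nat -> measure_display)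
    (T : forall n, measurableType (d n)) (P : forall n, probability (T n) R)
    (I : forall n, 'I_n -> 'I_n -> {RV (P n) >-> bool}) (beta B : R) : R :=
  lim ((n%:R^-1 * ln (annealed_partition (@I n) beta B)) @[n --> \oo]).

End AnnealedPotts.

Section Limit.
Context {R : realType} (d : measure_display) (T : measurableType d).
Variables (P : probability T R) (W : {RV P >-> R}) (q : nat) (k1 : 'I_q).

Definition beta' (beta : R) : R := expR beta - 1.

Definition scaled_exp (beta y : R) (omega : T) : R :=
  beta' beta / mean P W * y * W omega.

Definition potts_functional (beta B : R) (y : 'rV[R]_q) : R :=
  mean P (fun omega =>
    ln (expR (scaled_exp beta (y 0 k1) omega + B)
        + \sum_(k < q | k != k1) expR (scaled_exp beta (y 0 k) omega)))
  - beta' beta / (2 * mean P W) * \sum_(k < q) y 0 k ^+ 2.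

Definition potts_optimizer (beta B : R) : 'rV[R]_q :=
  get [set y | forall z, potts_functional beta B z <= potts_functional beta B y].

Definition x1_star (beta B : R) : R :=
  let y := potts_optimizer beta B in
  mean P (fun omega =>
    expR (scaled_exp beta (y 0 k1) omega + B)
    / (expR (scaled_exp beta (y 0 k1) omega + B)
       + \sum_(k < q | k != k1) expR (scaled_exp beta (y 0 k) omega))).

Definition scrF (B t : R) : R :=
  mean P (fun omega =>
    W omega / mean P W *
    ((expR (t * W omega + B) - 1) / (expR (t * W omega + B) + q%:R - 1))).

Definition zero_crossing (B : R) : Prop :=
  exists tstar : R,
    [/\ 0 < tstar,
        forall t, 0 < t < tstar -> 0 < derive1n 2 (scrF B) t,
        forall t, tstar < t -> derive1n 2 (scrF B) t < 0 &
        scrF B tstar / tstar < derive1 (scrF B) tstar].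

Definition p_fun (beta B s : R) : R :=
  mean P (fun omega => ln (expR (beta' beta * W omega * s + B) + q%:R - 1))
  - beta' beta * mean P W / (2 * q%:R) * ((q%:R - 1) * s ^+ 2 + 2 * s - 1).

Definition p_maximizers (beta B : R) : set R :=
  [set s | 0 <= s <= 1 /\
           forall u, 0 <= u <= 1 -> p_fun beta B u <= p_fun beta B s].

(* The values of beta at which the maximizer of p over [0, 1] is not unique form
   a singleton under the zero-crossing condition, and [get] picks its element;
   likewise in potts_optimizer, the argmax is a singleton off the critical
   beta. *)
Definition critical_beta (B : R) : R :=
  get [set beta | 0 < beta /\
    exists s u : R, [/\ p_maximizers beta B s, p_maximizers beta B u & s != u]].

End Limit.

(* Main.v *)
(** Averaging over the edges turns the Potts weight into a product over pairs, whose
    logarithm is, up to an error [o(n)] controlled by the uniform integrability of the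
    weights, the mean-field energy [b / (2 l) * sum_k S_k ^ 2] with [b = e ^ beta - 1] and
    [S_k] the total weight of colour [k].  Linearizing each square (from below by a tangent,
    from above on a finite grid) decouples the vertices and identifies the pressure with
    the maximum over [z] of
    [Phi z = E (ln sum_k e ^ (B 1_{k = 1} + b W z_k)) - b E W / 2 * sum_k z_k ^ 2].
    A maximizer is a fixed point of the mean-field map; convexity of the exponential and
    [B > 0] force the coordinates other than the first to be equal, so the maximum is that
    of [p] over [0, 1], and a maximizer [s] satisfies [F (b s) = s].  Two maximizers at the
    same [beta] give, by Rolle, three points of the graph of [F] on one line through the origin,
    hence lie on both sides of the inflection point [t_*]; as [b s] is nondecreasing in [beta],
    this happens for at most one [beta].  Off that value the maximizer is unique, so the
    pressure is differentiable in [B] (envelope argument), and convexity of the finite-volume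
    pressures makes their derivatives, the mean proportions of spins 1, converge. *)
Require Import Defs.
From HB Require Import structures.
From mathcomp Require Import all_boot all_order all_algebra.
From mathcomp Require Import perm ring lra.
From mathcomp Require Import all_classical all_reals all_analysis measurable_realfun.

Set Implicit Arguments.
Unset Strict Implicit.
Unset Printing Implicit Defensive.

Import Order.TTheory GRing.Theory Num.Theory.
Import numFieldNormedType.Exports.

Local Open Scope classical_set_scope.
Local Open Scope ring_scope.

(** * Log-sum-exp and Gibbs weights *)

(** No derivative of an expectation is obtained by exchanging limit and integral. It comes from a
    pointwise tangent inequality, which survives averaging, together with continuity of the slope.
    Likewise stationarity of a maximizer comes from a quantitative ascent step, which also replaces
    coercivity on the unbounded domain. The second derivative of [scrF] is never computed:
    derivatives take the value 0 where the limit is missing, so the strict signs in [zero_crossing]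
    themselves supply the derivability that is used. The weights are unbounded, so with
    [u = w_i w_j / l] the edge probability [u / (1 + u)] is not uniformly close to [u]. A truncation
    treats light pairs by a second-order expansion and heavy ones by the tail bound, whose exponent
    [tau - 1 > 1] makes a dyadic series converge uniformly in [n]. The variational problem is used
    in the variable [z = y / E W], in which [z_k] is the share of the total weight carried by colour
    [k]. *)

Section LogSumExp.
Context {R : realType} {K : finType}.
Implicit Types (a d : K -> R) (k : K).

Definition lse a : R := ln (\sum_k expR (a k)).

Definition gibbs a k : R := expR (a k - lse a).

Lemma sum_expR_gt0 (k0 : K) a : 0 < \sum_k expR (a k).
Proof.
by rewrite (bigD1 k0)//= ltr_wpDr ?expR_gt0// sumr_ge0// => k _; exact: expR_ge0.
Qed.

Lemma expR_lse (k0 : K) a : expR (lse a) = \sum_k expR (a k).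
Proof. by rewrite /lse lnK// posrE (sum_expR_gt0 k0). Qed.

Lemma gibbs_ge0 a k : 0 <= gibbs a k. Proof. exact: expR_ge0. Qed.

Lemma gibbsE a k : gibbs a k = expR (a k) / \sum_j expR (a j).
Proof. by rewrite /gibbs expRB (expR_lse k). Qed.

Lemma sum_gibbs (k0 : K) a : \sum_k gibbs a k = 1.
Proof.
under eq_bigr do rewrite gibbsE.
by rewrite -mulr_suml divff// gt_eqF// (sum_expR_gt0 k0).
Qed.

Lemma gibbs_le1 a k : gibbs a k <= 1.
Proof.
rewrite -(sum_gibbs k a) (bigD1 k)//= lerDl sumr_ge0// => j _.
exact: gibbs_ge0.
Qed.

Lemma normr_gibbs_le1 a k : `|gibbs a k| <= 1.
Proof. by rewrite ger0_norm ?gibbs_ge0 ?gibbs_le1. Qed.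

Lemma eq_lse a d : a =1 d -> lse a = lse d.
Proof. by move=> ad; rewrite /lse; under eq_bigr do rewrite ad. Qed.

Lemma lseD (k0 : K) a c : lse (fun k => a k + c) = lse a + c.
Proof.
apply: expR_inj; rewrite expRD !(expR_lse k0) mulr_suml.
by apply: eq_bigr => k _; rewrite expRD.
Qed.

Lemma le_lse (k0 : K) a d : (forall k, a k <= d k) -> lse a <= lse d.
Proof.
move=> ad; rewrite /lse ler_ln ?posrE ?(sum_expR_gt0 k0)//.
by apply: ler_sum => k _; rewrite ler_expR.
Qed.

(* Jensen: the tangent of [expR] at the Gibbs average of [d - a] bounds the Gibbs
   average of [expR (d - a)] from below. *)
Lemma lse_tangent (k0 : K) a d :
  lse a + \sum_k gibbs a k * (d k - a k) <= lse d.
Proof.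
set c := \sum_k _.
rewrite -ler_expR (expR_lse k0) expRD.
have -> : \sum_k expR (d k) =
    expR (lse a) * \sum_k gibbs a k * expR (d k - a k).
  rewrite mulr_sumr; apply: eq_bigr => k _.
  by rewrite /gibbs -expRD -expRD; congr expR; ring.
rewrite ler_pM2l ?expR_gt0//.
have -> : expR c = \sum_k gibbs a k * (expR c * (1 + (d k - a k - c))).
  have cE : c = \sum_k gibbs a k * (d k - a k) by [].
  transitivity (expR c * (\sum_k gibbs a k * (d k - a k) +
                          (1 - c) * \sum_k gibbs a k)).
    by rewrite -cE (sum_gibbs k0); ring.
  rewrite [(1 - c) * _]mulr_sumr -big_split/= mulr_sumr.
  by apply: eq_bigr => k _; ring.
apply: ler_sum => k _; rewrite ler_wpM2l ?gibbs_ge0//.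
have -> : d k - a k = c + (d k - a k - c) by ring.
rewrite expRD ler_wpM2l ?expR_ge0//.
have -> : c + (d k - a k - c) - c = d k - a k - c by ring.
exact: expR_ge1Dx.
Qed.

Lemma lse_lipschitz (k0 : K) a d e :
  (forall k, `|a k - d k| <= e) -> `|lse a - lse d| <= e.
Proof.
move=> ade.
have H x y : (forall k, x k <= y k + e) -> lse x - lse y <= e.
  by move=> xy; rewrite lerBlDl -(lseD k0); apply: le_lse.
rewrite ler_norml; apply/andP; split.
  rewrite lerNl opprB; apply: H => k.
  by have := ade k; rewrite ler_norml => /andP[]; lra.
by apply: H => k; have := ade k; rewrite ler_norml => /andP[]; lra.
Qed.

(** Distributivity of a product of sums: for an energy that is a sum over vertices the partition
    function factors. This is what the linearization of the squares is for. *)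
Lemma sum_ffun_expR (k0 : K) (n : nat) (f : 'I_n -> K -> R) :
  \sum_(s : {ffun 'I_n -> K}) expR (\sum_i f i (s i)) =
  expR (\sum_i lse (f i)).
Proof.
rewrite expR_sum.
under [RHS]eq_bigr do rewrite (expR_lse k0).
rewrite bigA_distr_bigA/=; apply: eq_bigr => s _.
by rewrite expR_sum.
Qed.

End LogSumExp.
Arguments lse {R K}.
Arguments gibbs {R K}.

Lemma lse_ffun (R : realType) (K : finType) (k0 : K) (n : nat) (f : 'I_n -> K -> R) :
  lse (fun s : {ffun 'I_n -> K} => \sum_i f i (s i)) = \sum_i lse (f i).
Proof. by rewrite {1}/lse (sum_ffun_expR k0) expRK. Qed.

(** * The two-valued case: logistic weight and softplus *)

Section Logistic.
Context {R : realType}.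
Implicit Types c u v : R.

(** For [c = q - 1]: the Gibbs probability of one colour whose exponent exceeds by [u] the common
    exponent of the [q - 1] others. *)
Definition logistic c u : R := expR u / (expR u + c).

Lemma logistic_ge0 c u : 0 <= c -> 0 <= logistic c u.
Proof. by move=> c0; rewrite divr_ge0 ?expR_ge0// addr_ge0 ?expR_ge0. Qed.

Lemma logistic_le1 c u : 0 <= c -> logistic c u <= 1.
Proof.
move=> c0; rewrite ler_pdivrMr ?mul1r ?lerDl//.
by rewrite ltr_wpDr// expR_gt0.
Qed.

Lemma logistic_incr c u v : 0 <= c -> u <= v -> logistic c u <= logistic c v.
Proof.
move=> c0 uv; have eu := expR_gt0 u; have ev := expR_gt0 v.
rewrite ler_pdivrMr ?ltr_wpDr// -mulrA mulrCA ler_pdivlMl ?ltr_wpDr//.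
have : expR u <= expR v by rewrite ler_expR.
by nra.
Qed.

Lemma logistic_lipschitz c u v : 0 <= c ->
  `|logistic c u - logistic c v| <= `|u - v|.
Proof.
move=> c0; wlog uv : u v / v <= u.
  by move=> H; have [/H//|/ltW/H] := leP v u; rewrite distrC [leRHS]distrC.
rewrite !ger0_norm ?subr_ge0 ?logistic_incr//.
have eu := expR_gt0 u; have ev := expR_gt0 v.
have euv : expR v <= expR u by rewrite ler_expR.
have h := expR_ge1Dx (v - u); rewrite expRB in h.
(* Since [e^(v - u) >= 1 + (v - u)], the quantity [1 - e^(v - u)] is at most [u - v]; that it
   dominates the difference is a rational inequality in [expR u] and [expR v]. *)
apply: (@le_trans _ _ (1 - expR v / expR u)); last lra.
rewrite /logistic -subr_ge0.
have -> : 1 - expR v / expR u - (expR u / (expR u + c) - expR v / (expR v + c))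
  = (expR u - expR v) * (expR u * expR v + c * expR v + c ^+ 2) /
    (expR u * (expR u + c) * (expR v + c)).
  field; rewrite !gt_eqF ?ltr_wpDr//.
rewrite divr_ge0// ?mulr_ge0 ?subr_ge0 ?addr_ge0 ?mulr_ge0 ?sqr_ge0//; exact/ltW.
Qed.

(* Jensen for the two-point measure with weights [logistic c u] and
   [1 - logistic c u]. *)
Lemma softplus_tangent c u v : 0 <= c ->
  ln (expR u + c) + logistic c u * (v - u) <= ln (expR v + c).
Proof.
move=> c0; set y := logistic c u * (v - u).
have pos t : 0 < expR t + c by rewrite ltr_wpDr ?expR_gt0.
rewrite -ler_expR expRD !lnK ?posrE//.
have hu : expR u * (expR y * (1 + (v - u - y))) <= expR v.
  have -> : v = u + (y + (v - u - y)) by ring.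
  rewrite [leRHS]expRD ler_wpM2l ?expR_ge0// [leRHS]expRD ler_wpM2l ?expR_ge0//.
  by rewrite (_ : u + (y + (v - u - y)) - u - y = v - u - y) ?expR_ge1Dx//; ring.
have hc : c * (expR y * (1 - y)) <= c.
  rewrite -[leRHS]mulr1 ler_wpM2l// -[leRHS](expR0 R) -(subrr y) expRD.
  by rewrite ler_wpM2l ?expR_ge0// expR_ge1Dx.
apply: le_trans (lerD hu hc).
have yE : (expR u + c) * y = expR u * (v - u).
  by rewrite /y /logistic; field; rewrite gt_eqF.
rewrite le_eqVlt; apply/orP; left; apply/eqP.
transitivity (expR y * (expR u + c - (expR u + c) * y + expR u * (v - u))).
  by rewrite yE; ring.
by ring.
Qed.

Lemma softplus_lipschitz c u v : 0 <= c ->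
  `|ln (expR u + c) - ln (expR v + c)| <= `|u - v|.
Proof.
move=> c0; wlog uv : u v / v <= u.
  by move=> H; have [/H//|/ltW/H] := leP v u; rewrite distrC [leRHS]distrC.
have := softplus_tangent u v c0; have := softplus_tangent v u c0.
have := logistic_ge0 u c0; have := logistic_le1 u c0.
have := logistic_ge0 v c0; have := logistic_le1 v c0.
set lu := logistic c u; set lv := logistic c v => ? lv0 ? lu0 h1 h2.
have h3 : 0 <= lv * (u - v) by rewrite mulr_ge0 ?subr_ge0.
have h4 : lu * (u - v) <= u - v by rewrite ler_piMl ?subr_ge0.
by rewrite !ger0_norm ?subr_ge0//; lra.
Qed.

End Logistic.

(** * Derivatives *)

Section Derivatives.
Context {R : realType}.
Implicit Types (f g : R -> R) (x l : R).

(** Dividing by [y - x] traps the difference quotient between [l] and [g y], in one order for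
    [y > x] and in the other for [y < x]. The bounds are asymmetric, a fixed slope and a moving one,
    as an envelope argument produces them. *)
Lemma is_derive_squeeze f g x l :
  (\forall y \near x, (y - x) * l <= f y - f x <= (y - x) * g y) ->
  g y @[y --> x] --> l -> is_derive x 1 f l.
Proof.
move=> fl gl.
have lim : h^-1 *: (f (h *: 1 + x) - f x) @[h --> 0^'] --> l.
  apply/cvgrPdist_le => e e0.
  have gle : \forall y \near x, `|l - g y| <= e.
    by move/cvgrPdist_le : gl => /(_ e e0).
  have : \forall h \near (0 : R)^', (h + x - x) * l <= f (h + x) - f x
      <= (h + x - x) * g (h + x) /\ `|l - g (h + x)| <= e.
    have H : (h + x) @[h --> (0:R)^'] --> x.
      have : (h + x) @[h --> (0:R)] --> 0 + x by apply: cvgD => //; exact: cvg_cst.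
      rewrite add0r => H; apply: cvg_trans H.
      by move=> A /nbhs_dnbhs; apply.
    have K : \forall h \near (0:R)^', ((fun y => (y - x) * l <= f y - f x <=
        (y - x) * g y) `&` (fun y => `|l - g y| <= e)) (h + x).
      exact: H (filterI fl gle).
    by near=> h; have [] : ((fun y => (y - x) * l <= f y - f x <=
        (y - x) * g y) `&` (fun y => `|l - g y| <= e)) (h + x) by near: h.
  move=> H; near=> h.
  have h0 : h != 0 by near: h; exact: nbhs_dnbhs_neq.
  have [] : (h + x - x) * l <= f (h + x) - f x <= (h + x - x) * g (h + x) /\
            `|l - g (h + x)| <= e by near: h.
  rewrite addrK /GRing.scale/= mulr1 => /andP[h1 h2] h3.
  apply: le_trans h3.
  have [hp|hn|/eqP] := ltgtP h 0; last by rewrite (negbTE h0).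
    have k1 : h^-1 * (f (h + x) - f x) <= l by rewrite ler_ndivrMl.
    have k2 : g (h + x) <= h^-1 * (f (h + x) - f x) by rewrite ler_ndivlMl.
    rewrite !ger0_norm; lra.
  have k1 : h^-1 * (f (h + x) - f x) <= g (h + x) by rewrite ler_pdivrMl.
  have k2 : l <= h^-1 * (f (h + x) - f x) by rewrite ler_pdivlMl.
  rewrite !ler0_norm; lra.
apply: DeriveDef; first by apply/cvg_ex; exists l.
exact/cvg_lim.
Unshelve. all: by end_near. Qed.

(** Exchanging the two points in the tangent inequality yields both sides of the squeeze. *)
Lemma is_derive_tangent f g x : {for x, continuous g} ->
  (forall y z, f y + g y * (z - y) <= f z) -> is_derive x 1 f (g x).
Proof.
move=> cg fg; apply: (@is_derive_squeeze f g) => //.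
by near=> y; have := fg x y; have := fg y x; lra.
Unshelve. all: by end_near. Qed.

Lemma nondecreasing_derive1_ge0 f x : {homo f : y z / y <= z} ->
  derivable f x 1 -> 0 <= derive1 f x.
Proof.
move=> ndf df; rewrite derive1E; apply: limr_ge => //.
near=> h; rewrite /GRing.scale/= mulr1.
have [h0|h0] := ltP 0 h.
  by rewrite mulr_ge0 ?invr_ge0 ?(ltW h0)// subr_ge0 ndf// lerDr ltW.
by rewrite mulr_le0// ?invr_le0// subr_le0 ndf// gerDr.
Unshelve. all: by end_near. Qed.

Lemma lipschitz_continuous f L : (forall y z, `|f y - f z| <= L * `|y - z|) ->
  continuous f.
Proof.
move=> fL x.
have L0 : 0 <= L.
  by have := le_trans (normr_ge0 _) (fL 1 0); rewrite subr0 normr1 mulr1.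
apply/cvgrPdist_le => e e0.
have d0 : 0 < e / (L + 1) by rewrite divr_gt0// ltr_wpDl.
near=> y; rewrite (le_trans (fL _ _))//.
have yx : `|x - y| <= e / (L + 1) by near: y; exact: cvgr_dist_le.
apply: (@le_trans _ _ ((L + 1) * `|x - y|)); first by rewrite ler_wpM2r// lerDl.
by rewrite mulrC -ler_pdivlMr// ltr_wpDl.
Unshelve. all: by end_near. Qed.

(* A difference quotient without limit is given the derivative 0. *)
Lemma derive1_neq0_derivable f x : derive1 f x != 0 -> derivable f x 1.
Proof.
rewrite derive1E /derive => fx; apply: contrapT => nd.
by move: fx; rewrite dvgP//= eqxx.
Qed.

End Derivatives.

(** * Means of integrable random variables *)

Section Mean.
Context {R : realType} {d : measure_display} {T : measurableType d}.
Variable P : probability T R.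
Implicit Types (X Y : T -> R) (c : R).

Definition has_mean X := P.-integrable setT (EFin \o X).

Lemma meanE X : mean P X = (\int[P]_x X x)%R.
Proof. by rewrite /mean unlock. Qed.

Lemma eq_mean X Y : X =1 Y -> mean P X = mean P Y.
Proof. by move=> /funext ->. Qed.

Lemma eq_has_mean X Y : X =1 Y -> has_mean X -> has_mean Y.
Proof. by move=> /funext ->. Qed.

Lemma has_mean_cst c : has_mean (fun=> c).
Proof. exact: finite_measure_integrable_cst. Qed.

Lemma has_meanD X Y : has_mean X -> has_mean Y -> has_mean (fun x => X x + Y x).
Proof. by move=> sX sY; have := integrableD measurableT sX sY. Qed.

Lemma has_meanZ c X : has_mean X -> has_mean (fun x => c * X x).
Proof. by move=> sX; have := integrableZl measurableT c sX. Qed.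

Lemma has_meanB X Y : has_mean X -> has_mean Y -> has_mean (fun x => X x - Y x).
Proof. by move=> sX sY; have := integrableB measurableT sX sY. Qed.

Lemma has_mean_sum (I : finType) (p : pred I) (X : I -> T -> R) :
  (forall i, has_mean (X i)) -> has_mean (fun x => \sum_(i | p i) X i x).
Proof.
move=> sX; apply: (eq_integrable measurableT); last first.
  apply: (@integrable_sum _ _ _ P _ measurableT _ (index_enum I) p
    (fun i => EFin \o X i)) => i _; exact: sX.
by move=> x _ /=; rewrite sumEFin.
Qed.

Lemma has_mean_le X Y : measurable_fun setT X -> has_mean Y ->
  (forall x, `|X x| <= `|Y x|) -> has_mean X.
Proof.
move=> mX sY XY; apply: le_integrable sY => //; first exact/measurable_EFinP.
by move=> x _ /=; rewrite lee_fin.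
Qed.

Lemma has_mean_measurable X : has_mean X -> measurable_fun setT X.
Proof. by move=> /integrableP[/measurable_EFinP]. Qed.

Lemma mean_cst c : mean P (fun=> c) = c.
Proof. by rewrite /mean (expectation_cst P c). Qed.

Lemma meanD X Y : has_mean X -> has_mean Y ->
  mean P (fun x => X x + Y x) = mean P X + mean P Y.
Proof. by move=> sX sY; rewrite !meanE RintegralD. Qed.

Lemma meanB X Y : has_mean X -> has_mean Y ->
  mean P (fun x => X x - Y x) = mean P X - mean P Y.
Proof. by move=> sX sY; rewrite !meanE RintegralB. Qed.

Lemma meanZ c X : has_mean X -> mean P (fun x => c * X x) = c * mean P X.
Proof. by move=> sX; rewrite !meanE RintegralZl. Qed.

Lemma mean_sum (I : finType) (p : pred I) (X : I -> T -> R) :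
  (forall i, has_mean (X i)) ->
  mean P (fun x => \sum_(i | p i) X i x) = \sum_(i | p i) mean P (X i).
Proof.
move=> sX; rewrite /mean unlock.
under eq_integral do rewrite -sumEFin.
rewrite (@integral_sum _ _ _ P _ measurableT _ (fun i => EFin \o X i))//.
rewrite -sum_fine//= => i _.
exact: (integrable_fin_num measurableT (sX i)).
Qed.

Lemma ae_mean_le X Y : has_mean X -> has_mean Y ->
  {ae P, forall x, X x <= Y x} -> mean P X <= mean P Y.
Proof.
move=> sX sY XY.
have sD := has_meanB sY sX.
rewrite -subr_ge0 -meanB// meanE /Rintegral fine_ge0//.
have -> : (\int[P]_x (Y x - X x)%:E = \int[P]_x (Num.max (Y x - X x) 0)%:E)%E.
  apply: ae_eq_integral => //.
  - exact/measurable_EFinP/has_mean_measurable.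
  - apply/measurable_EFinP; apply: measurable_maxr => //.
    exact: has_mean_measurable.
  - apply: filterS XY => x h _; rewrite max_l// subr_ge0//.
by apply: integral_ge0 => x _; rewrite lee_fin le_max lexx orbT.
Qed.

Lemma mean_le X Y : has_mean X -> has_mean Y -> (forall x, X x <= Y x) ->
  mean P X <= mean P Y.
Proof. by move=> sX sY XY; apply: ae_mean_le => //; exact: aeW. Qed.

Lemma ae_mean_ge0 X : has_mean X -> {ae P, forall x, 0 <= X x} -> 0 <= mean P X.
Proof.
by move=> sX X0; rewrite -(mean_cst 0); apply: ae_mean_le => //; exact: has_mean_cst.
Qed.

Lemma has_mean_norm X : has_mean X -> has_mean (fun x => `|X x|).
Proof.
move=> sX; apply: (has_mean_le _ sX) => [|x]; last by rewrite normr_id.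
by apply: measurableT_comp => //; exact: has_mean_measurable.
Qed.

Lemma ler_norm_mean X Y : has_mean X -> has_mean Y ->
  (forall x, `|X x| <= Y x) -> `|mean P X| <= mean P Y.
Proof.
move=> sX sY XY; rewrite ler_norml lerNl -mulN1r -meanZ//.
by rewrite !mean_le//; [|exact: has_meanZ|] => x; have := XY x;
  rewrite ler_norml; lra.
Qed.

Lemma has_mean_indic (A : set T) : measurable A -> has_mean (\1_A).
Proof. by move=> mA; exact: integrable_indic. Qed.

Lemma mean_indic (A : set T) : measurable A -> mean P \1_A = fine (P A).
Proof. by move=> mA; rewrite /mean expectation_indic. Qed.

End Mean.


(** * Annealed weights *)

Section Edges.
Context {R : realType} {d : measure_display} {T : measurableType d}.
Variables (P : probability T R) (E : finType) (D : {set E}).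
Variables (X : E -> {RV P >-> bool}) (p c : E -> R).
Hypothesis Xindep : independent_on P D (fun e => X e : T -> bool).
Hypothesis Xp : forall e, e \in D -> P [set x | X e x] = (p e)%:E.

Let measurable_all (J : {set E}) :
  measurable [set x | forall e, e \in J -> X e x].
Proof.
have -> : [set x | forall e, e \in J -> X e x] =
    \bigcap_(e in [set` J]) (X e @^-1` [set true]).
  by apply/seteqP; split => x /= H e; exact: H.
apply: fin_bigcap_measurable => // e _.
by rewrite -[_ @^-1` _]setTI; exact: measurable_funPT.
Qed.

Let prod_indicator (J : {set E}) x :
  \prod_(e in J) (X e x)%:R = \1_[set x | forall e, e \in J -> X e x] x :> R.
Proof.
rewrite indicE; case: (boolP [forall e in J, X e x]) => h.
  rewrite mem_set/=; last by move=> e eJ; exact: (forall_inP h).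
  by rewrite big1// => e eJ; rewrite (forall_inP h e eJ).
rewrite memNset/=; last by move=> H; move/negP : h; apply; exact/forall_inP.
move: h => /forall_inPn[e eJ /negbTE Xe].
by rewrite (bigD1 e)//= Xe mul0r.
Qed.

(** Extending [c] by 0 off [D] lets the product be expanded over all subsets of [E]; those not
    contained in [D], about which independence says nothing, get coefficient 0. *)
Let c' e := if e \in D then c e else 0.

Let prod_expand (u : E -> R) : \prod_(e in D) (1 + c e * u e) =
  \sum_(J : {set E}) (\prod_(e in J) c' e * \prod_(e in J) u e).
Proof.
transitivity (\prod_e (c' e * u e + 1)).
  rewrite big_mkcond/=; apply: eq_bigr => e _.
  by rewrite /c'; case: ifP => _; rewrite ?mul0r ?add0r// addrC.
rewrite bigA_distr; apply: eq_bigr => J _.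
by rewrite -big_mkcond/= big_split.
Qed.

Let has_mean_prod (J : {set E}) :
  has_mean P (fun x => \prod_(e in J) (X e x)%:R).
Proof.
apply: (@eq_has_mean _ _ _ _ (\1_[set x | forall e, e \in J -> X e x])).
  by move=> x; rewrite prod_indicator.
exact: has_mean_indic.
Qed.

Lemma has_mean_prod_edges :
  has_mean P (fun x => \prod_(e in D) (1 + c e * (X e x)%:R)).
Proof.
apply: (@eq_has_mean _ _ _ _ (fun x => \sum_(J : {set E})
  (\prod_(e in J) c' e * \prod_(e in J) (X e x)%:R))).
  by move=> x; rewrite prod_expand.
by apply: has_mean_sum => J; apply: has_meanZ; exact: has_mean_prod.
Qed.

(** In the expanded product each monomial is the indicator that all edges of [J] are present.
    Independence factors its mean, and the same expansion read backwards, with [p] for the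
    indicators, rebuilds the product. *)
Lemma mean_prod_edges :
  mean P (fun x => \prod_(e in D) (1 + c e * (X e x)%:R)) =
  \prod_(e in D) (1 + c e * p e).
Proof.
rewrite prod_expand (eq_mean _ (fun x => prod_expand (fun e => (X e x)%:R))).
rewrite mean_sum => [|J]; last by apply: has_meanZ; exact: has_mean_prod.
apply: eq_bigr => J _; rewrite meanZ//.
have [JD|/subsetPn[e eJ eD]] := boolP (J \subset D); last first.
  have c'0 : c' e = 0 by rewrite /c' (negbTE eD).
  by rewrite !(bigD1 e eJ)/= c'0 !mul0r.
congr *%R.
rewrite (eq_mean _ (prod_indicator J)) mean_indic//.
rewrite (Xindep (A := fun=> [set true]) JD)//; apply: eq_bigr => e eJ.
by rewrite (_ : _ @^-1` _ = [set x | X e x])// Xp// (fintype.subsetP JD).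
Qed.

End Edges.

Section AnnealedWeight.
Context {R : realType} {q : nat} (k1 : 'I_q).

Definition rank1_prob (n : nat) (w : 'I_n -> R) (i j : 'I_n) : R :=
  w i * w j / (total_weight w + w i * w j).

Definition field1 (B : R) (k : 'I_q) : R := if k == k1 then B else 0.

(** An edge indicator takes the values 0 and 1, so [e^(beta I) = 1 + beta' I]: the exponential of
    the Hamiltonian is affine in each edge, and its mean only sees the edge probabilities. *)
Lemma annealed_weightE (n : nat) (w : 'I_n -> R) (d : measure_display)
    (T : measurableType d) (P : probability T R) (I : 'I_n -> 'I_n -> {RV P >-> bool})
    beta B (s : {ffun 'I_n -> 'I_q}) : rank1_graph w I ->
  annealed_weight k1 I beta B s = expR (\sum_i field1 B (s i)) *
    \prod_(e : 'I_n * 'I_n | (e.1 < e.2)%N)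
      (1 + beta' beta * (s e.1 == s e.2)%:R * rank1_prob w e.1 e.2).
Proof.
move=> [Iindep Ip]; rewrite /annealed_weight.
set D := [set e : 'I_n * 'I_n | (e.1 < e.2)%N]%SET in Iindep *.
have -> : \prod_(e : 'I_n * 'I_n | (e.1 < e.2)%N)
      (1 + beta' beta * (s e.1 == s e.2)%:R * rank1_prob w e.1 e.2) =
    \prod_(e in D) (1 + beta' beta * (s e.1 == s e.2)%:R * rank1_prob w e.1 e.2).
  by apply: eq_bigl => e; rewrite inE.
rewrite -(mean_prod_edges (X := fun e => I e.1 e.2)
  (fun e => beta' beta * (s e.1 == s e.2)%:R) Iindep); last first.
  by move=> [i j]; rewrite inE/= => /Ip.
rewrite -meanZ; last first.
  exact: has_mean_prod_edges.
apply: eq_mean => x; rewrite /hamiltonian addrC expRD; congr *%R.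
  congr expR; rewrite mulr_sumr; apply: eq_bigr => i _.
  by rewrite /field1; case: eqP => _; rewrite ?mulr1 ?mulr0.
rewrite pair_big_dep/= mulr_sumr expR_sum.
under [RHS]eq_bigl do rewrite inE.
apply: eq_bigr => -[i j] _ /=.
rewrite /beta'; case: (I i j x); case: eqP => _;
  rewrite ?(mulr1, mulr0, mul0r, expR0, addr0)//; by ring.
Qed.

End AnnealedWeight.


(** * Convergence of the empirical weight means *)

(** A monotone function has countably many discontinuities, a Lebesgue-null set, while []a, b[] has
    positive measure. *)
Lemma nondecreasing_continuity_point (R : realType) (F : R -> R) (a b : R) :
  {homo F : x y / x <= y} -> a < b ->
  exists x, [/\ a < x, x < b & {for x, continuous F}].
Proof.
move=> ndF ab.
have ndF' : {in `[a, b] &, nondecreasing_fun F} by move=> x y _ _; exact: ndF.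
have [x xab nx] : exists2 x, (x \in `]a, b[)%R & ~ discontinuity F x.
  apply: contrapT => H.
  have := countable_lebesgue_measure0 (discontinuity_countable ndF').
  have -> : [set x | (x \in `]a, b[)%R /\ discontinuity F x] = [set` (`]a, b[)].
    apply/seteqP; split => x /=; first by case.
    by move=> xab; split=> //; apply: contrapT => nx; apply: H; exists x.
  rewrite lebesgue_measure_itv/= lte_fin ab => /eqP.
  by rewrite -EFinB eqe subr_eq0 gt_eqF.
move: (xab); rewrite in_itv/= => /andP[ax xb]; exists x; split=> //.
(* That [x] is no [discontinuity] only gives equality of the one-sided limits; monotonicity places
   [F x] between them. *)
have cl : cvg (F y @[y --> x^'-]).
  apply: nondecreasing_at_left_is_cvgr; apply: nearW => s.
    by move=> u v _ _; exact: ndF.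
  by exists (F x) => z [y /=]; rewrite in_itv/= => /andP[_ /ltW yx] <-; exact: ndF.
have cr : cvg (F y @[y --> x^'+]).
  apply: nondecreasing_at_right_is_cvgr; apply: nearW => s.
    by move=> u v _ _; exact: ndF.
  by exists (F x) => z [y /=]; rewrite in_itv/= => /andP[/ltW yx _] <-; exact: ndF.
have lr : lim (F y @[y --> x^'-]) = lim (F y @[y --> x^'+]).
  by apply/eqP/negPn/negP => H; exact: nx.
have ll : lim (F y @[y --> x^'-]) <= F x.
  by apply: limr_le => //; near=> y; apply: ndF; apply/ltW; near: y; exact: nbhs_left_lt.
have rl : F x <= lim (F y @[y --> x^'+]).
  by apply: limr_ge => //; near=> y; apply: ndF; apply/ltW; near: y; exact: nbhs_right_gt.
apply/left_right_continuousP; split.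
  by have -> : F x = lim (F y @[y --> x^'-]) by apply/eqP; rewrite eq_le ll lr rl.
by have -> : F x = lim (F y @[y --> x^'+]) by apply/eqP; rewrite eq_le rl -lr ll.
Unshelve. all: by end_near. Qed.

Section StepApproximation.
Context {R : realType}.
Implicit Types (g : R -> R) (a : nat -> R) (L e x : R).

(** Written with the indicators of [a k < x] so that its mean only involves the distribution
    function at the points [a k]. For nondecreasing [a] the sum telescopes to the value of [g] at
    the first grid point not below [x], or at [a N] if there is none. *)
Definition step_fun g a N x : R :=
  g (a 0%N) + \sum_(k < N) (g (a k.+1) - g (a k)) * (a k < x)%R%:R.

Lemma step_fun_approx g a L e N x : 0 <= L -> 0 <= e ->
  (forall x y, `|g x - g y| <= L * `|x - y|) ->
  (forall k, a k <= a k.+1 <= a k + e) -> a 0%N < x ->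
  `|g x - step_fun g a N x| <= L * e + L * Num.max (x - a N) 0.
Proof.
move=> L0 e0 gL ae a0x.
have mono k : a k <= a k.+1 by case/andP : (ae k).
(* The induction on [N] needs the exact value beyond [a N], not just an estimate: the next jump
   starts from it. *)
suff : if a N < x then step_fun g a N x = g (a N)
       else `|g x - step_fun g a N x| <= L * e.
  case: ltP => [aNx ->|aNx h].
    rewrite max_l ?subr_ge0 ?(ltW aNx)//.
    rewrite (le_trans (gL _ _))// ger0_norm ?subr_ge0 ?(ltW aNx)//.
    by rewrite lerDr mulr_ge0.
  by rewrite max_r ?subr_le0// mulr0 addr0.
elim: N => [|N ih]; first by rewrite a0x /step_fun big_ord0 addr0.
have stepS : step_fun g a N.+1 x =
    step_fun g a N x + (g (a N.+1) - g (a N)) * (a N < x)%R%:R.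
  by rewrite /step_fun big_ord_recr/= addrA.
rewrite stepS; move: ih; have [xN|xN] := ltP (a N) x => ih.
  rewrite ih mulr1 addrC subrK; case: ltP => // xN1.
  rewrite (le_trans (gL _ _))// ler_wpM2l// ler0_norm ?subr_le0//.
  by have /andP[] := ae N; lra.
by rewrite mulr0 addr0 ltNge (le_trans xN)//=.
Qed.

End StepApproximation.


Section EmpiricalMean.
Context {R : realType}.

Definition empirical_mean (n : nat) (w : 'I_n -> R) (g : R -> R) : R :=
  n%:R^-1 * \sum_i g (w i).

Lemma empirical_mean_le (n : nat) (w : 'I_n -> R) (f g : R -> R) :
  (forall i, f (w i) <= g (w i)) -> empirical_mean w f <= empirical_mean w g.
Proof.
by move=> fg; rewrite ler_wpM2l ?invr_ge0//; apply: ler_sum => i _; exact: fg.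
Qed.

Lemma empirical_meanD (n : nat) (w : 'I_n -> R) (f g : R -> R) :
  empirical_mean w (fun x => f x + g x) = empirical_mean w f + empirical_mean w g.
Proof. by rewrite /empirical_mean big_split mulrDr. Qed.

Lemma empirical_meanZ (n : nat) (w : 'I_n -> R) c (f : R -> R) :
  empirical_mean w (fun x => c * f x) = c * empirical_mean w f.
Proof. by rewrite /empirical_mean -mulr_sumr mulrCA. Qed.

Lemma empirical_mean_sum (n : nat) (w : 'I_n -> R) (I : finType) (f : I -> R -> R) :
  empirical_mean w (fun x => \sum_k f k x) = \sum_k empirical_mean w (f k).
Proof. by rewrite /empirical_mean exchange_big mulr_sumr. Qed.

Lemma empirical_mean_cst (n : nat) (w : 'I_n -> R) c : (0 < n)%N ->
  empirical_mean w (fun=> c) = c.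
Proof.
move=> n0; rewrite /empirical_mean sumr_const card_ord -[c *+ n]mulr_natl mulKf//.
by rewrite pnatr_eq0 -lt0n.
Qed.

Lemma empirical_mean_tail_ind (n : nat) (w : 'I_n -> R) x : (0 < n)%N ->
  empirical_mean w (fun y => (x < y)%R%:R) = 1 - empirical_cdf w x.
Proof.
move=> n0; apply/eqP; rewrite -subr_eq0 opprB addrA subr_eq0; apply/eqP.
rewrite -[RHS](empirical_mean_cst w 1 n0) -[empirical_cdf w x]/(empirical_mean w
  (fun y => (y <= x)%R%:R)) -empirical_meanD; congr (_ * _).
by apply: eq_bigr => i _; case: ltP; rewrite ?addr0 ?add0r.
Qed.

(** One doubling reads [(x - y)^+ <= y 1_{y < x} + (x - 2 y)^+]. Iterating it expresses an excess by
    tail indicators, which the tail hypothesis bounds. *)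
Lemma dyadic_excess (x : R) N J :
  Num.max (x - 2 ^+ N) 0 <=
  \sum_(j < J) 2 ^+ (N + j) * (2 ^+ (N + j) < x)%R%:R
  + Num.max (x - 2 ^+ (N + J)) 0.
Proof.
elim: J => [|J ih]; first by rewrite big_ord0 add0r addn0.
apply: (le_trans ih); rewrite big_ord_recr/= -addrA lerD2l addnS exprS.
set y : R := 2 ^+ (N + J).
have y0 : 0 <= y by rewrite exprn_ge0.
have := le_max (x - 2 * y) (x - 2 * y) 0; have := le_max 0 (x - 2 * y) 0.
rewrite !lexx orbT/= => m0 m1.
case: (ltP y x) => yx; last by rewrite max_r ?mulr0 ?add0r ?subr_le0.
by rewrite max_l ?subr_ge0 ?(ltW yx)// mulr1; lra.
Qed.

Lemma geometric_sum_le (r : R) J : 0 <= r < 1 ->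
  \sum_(j < J) r ^+ j <= (1 - r)^-1.
Proof.
move=> /andP[r0 r1]; rewrite -[leRHS]mul1r ler_pdivlMr ?subr_gt0//.
by rewrite mulrC -opprB mulNr -subrX1 opprB gerBl exprn_ge0.
Qed.

(** Uniform integrability. Level [y = 2^(N + j)] contributes at most [c y^(2 - tau) = c r^(N + j)],
    where [r = 2^(2 - tau) < 1] because [tau > 2]; the geometric series does not see [n]. *)
Lemma empirical_excess_cvg (w : forall n : nat, 'I_n -> R) (c tau : R) :
  0 < c -> 2 < tau ->
  (forall n x, (0 < n)%N -> 1 <= x ->
    1 - empirical_cdf (@w n) x <= c * x `^ (- (tau - 1))) ->
  forall e, 0 < e -> \forall N \near \oo,
    forall n, empirical_mean (@w n) (fun x => Num.max (x - 2 ^+ N) 0) <= e.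
Proof.
move=> c0 tau2 tail e e0.
pose r : R := 2 `^ (2 - tau).
have r0 : 0 < r by rewrite powR_gt0.
have r1 : r < 1.
  rewrite /r /powR pnatr_eq0/= expR_lt1 pmulr_llt0 ?ln_gt0 ?ltr1n//.
  by rewrite subr_lt0.
have cr : c * r ^+ N / (1 - r) @[N --> \oo] --> (0 : R).
  have : c * r ^+ N / (1 - r) @[N --> \oo] --> c * 0 / (1 - r).
    apply: cvgM; last exact: cvg_cst.
    by apply: cvgM; [exact: cvg_cst|apply: cvg_expr; rewrite ger0_norm// ltW].
  by rewrite mulr0 mul0r.
have crN : \forall N \near \oo, c * r ^+ N / (1 - r) <= e.
  move/cvgrPdist_le : cr => /(_ e e0); apply: filterS => N.
  by rewrite sub0r normrN; apply: le_trans; exact: ler_norm.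
apply: filterS crN => N crN [|n].
  by rewrite /empirical_mean invr0 mul0r ltW.
pose s := \sum_i `|w n.+1 i|.
have s0 : 0 <= s by exact: sumr_ge0.
(* [J] depends on [n]: it is so large that no weight exceeds [2^(N + J)] and the last excess
   vanishes. The geometric bound is uniform in [J]. *)
pose J := (Num.truncn s).+1.
have sJ : s <= 2 ^+ (N + J).
  apply: (@le_trans _ _ J%:R); first by apply/ltW; exact: truncnS_gt.
  rewrite -natrX ler_nat (leq_trans (ltnW (ltn_expl J (ltnSn 1))))//.
  by rewrite leq_exp2l// leq_addl.
apply: le_trans crN; apply: (@le_trans _ _ (empirical_mean (@w n.+1) (fun x =>
    \sum_(j < J) 2 ^+ (N + j) * (2 ^+ (N + j) < x)%R%:R))).
  apply: empirical_mean_le => i; rewrite (le_trans (dyadic_excess _ N J))//.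
  rewrite [X in _ + X]max_r ?addr0// subr_le0 (le_trans _ sJ)// /s (bigD1 i)//=.
  by rewrite (le_trans (ler_norm _))// lerDl sumr_ge0.
rewrite empirical_mean_sum.
apply: (@le_trans _ _ (\sum_(j < J) c * r ^+ N * r ^+ j)); last first.
  rewrite -mulr_sumr ler_wpM2l ?mulr_ge0 ?exprn_ge0 ?(ltW c0) ?(ltW r0)//.
  by apply: geometric_sum_le; rewrite ltW.
apply: ler_sum => j _; rewrite empirical_meanZ empirical_mean_tail_ind//.
set y : R := 2 ^+ (N + j).
have y1 : 1 <= y by rewrite exprn_ege1// ler1n.
have y0 : 0 < y by exact: lt_le_trans y1.
have -> : c * r ^+ N * r ^+ j = y * (c * y `^ (- (tau - 1))).
  rewrite -mulrA -exprD mulrCA; congr *%R.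
  rewrite -{1}[y]powRr1 ?(ltW y0)// -powRD ?(gt_eqF y0) ?implybT//.
  rewrite (_ : 1 + - (tau - 1) = 2 - tau); last ring.
  have -> : y = 2 `^ (N + j)%:R by rewrite powR_mulrn.
  by rewrite -powRrM mulrC powRrM powR_mulrn ?(ltW r0).
by rewrite ler_wpM2l ?(ltW y0)// tail.
Qed.

End EmpiricalMean.

Section LimitWeight.
Context {R : realType} {dW : measure_display} {TW : measurableType dW}.
Variables (PW : probability TW R) (W : {RV PW >-> R}).
Hypothesis W2 : ('E_PW[(fun omega => W omega ^+ 2)%R] < +oo)%E.

Lemma has_mean_sq : has_mean PW (fun x => W x ^+ 2).
Proof.
have mW2 : measurable_fun setT (fun x => W x ^+ 2).
  by apply: measurable_funX; exact: measurable_funPT.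
apply/integrableP; split; first exact/measurable_EFinP.
move: W2; rewrite unlock; congr (_ < _)%E; apply: eq_integral => x _ /=.
by rewrite ger0_norm ?sqr_ge0.
Qed.

Lemma has_mean_quadratic (f : R -> R) (C : R) : measurable_fun setT f ->
  (forall x, `|f x| <= C * (1 + x ^+ 2)) -> has_mean PW (f \o W).
Proof.
move=> mf fC; apply: (@has_mean_le _ _ _ _ _ (fun x => C * (1 + W x ^+ 2))).
- by apply: measurableT_comp => //; exact: measurable_funPT.
- by apply: has_meanZ; apply: has_meanD; [exact: has_mean_cst|exact: has_mean_sq].
- by move=> x; rewrite (le_trans (fC _))// ler_norm.
Qed.

Lemma has_mean_linear (f : R -> R) (C : R) : 0 <= C -> measurable_fun setT f ->
  (forall x, `|f x| <= C * (1 + `|x|)) -> has_mean PW (f \o W).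
Proof.
move=> C0 mf fC; apply: (@has_mean_quadratic _ (2 * C)) => // x.
rewrite (le_trans (fC _))// -(real_normK (num_real x)).
rewrite [2 * C]mulrC -mulrA ler_wpM2l//.
by have := sqr_ge0 (`|x| - 1); rewrite sqrrB; nra.
Qed.

Lemma lipschitz_measurable (g : R -> R) L :
  (forall x y, `|g x - g y| <= L * `|x - y|) -> measurable_fun setT g.
Proof.
move=> gL; apply: continuous_measurable_fun; exact: lipschitz_continuous gL.
Qed.

Lemma has_mean_lipschitz (g : R -> R) L :
  (forall x y, `|g x - g y| <= L * `|x - y|) -> has_mean PW (g \o W).
Proof.
move=> gL; have mg := lipschitz_measurable gL.
have L0 : 0 <= L.
  by have := le_trans (normr_ge0 _) (gL 1 0); rewrite subr0 normr1 mulr1.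
apply: (@has_mean_linear _ (L + `|g 0|)) => // [|x]; first by rewrite addr_ge0.
have := gL x 0; rewrite subr0 => h.
have : `|g x| <= `|g x - g 0| + `|g 0|.
  by rewrite -[X in `|X| <= _](subrK (g 0)) ler_normD.
by have := normr_ge0 x; have := normr_ge0 (g 0); nra.
Qed.

Lemma has_mean_weight : has_mean PW W.
Proof. by apply: (@has_mean_lipschitz id 1) => x y; rewrite mul1r. Qed.

Lemma has_mean_excess (a : R) : has_mean PW (fun x => Num.max (W x - a) 0).
Proof.
apply: (@has_mean_lipschitz (fun x => Num.max (x - a) 0) 1) => x y.
rewrite mul1r.
by rewrite /Num.max; do 2 case: ifPn; rewrite -?leNgt => h1 h2;
  rewrite ler_norml; apply/andP; split;
  have := ler_norm (x - y); have := ler_norm (y - x); rewrite (distrC y x); lra.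
Qed.

Lemma excess_mean_cvg (e : R) : 0 < e -> \forall N \near \oo,
  mean PW (fun x => Num.max (W x - 2 ^+ N) 0) <= e.
Proof.
move=> e0; pose m2 := mean PW (fun x => W x ^+ 2).
have cm : (2^-1) ^+ N * m2 @[N --> \oo] --> (0 : R).
  have : (2^-1) ^+ N * m2 @[N --> \oo] --> 0 * m2.
    apply: cvgM; last exact: cvg_cst.
    by apply: cvg_expr; rewrite ger0_norm// invf_lt1// ltr1n.
  by rewrite mul0r.
move/cvgrPdist_le : cm => /(_ e e0); apply: filterS => N.
rewrite sub0r normrN => h; apply: le_trans (le_trans (ler_norm _) h).
rewrite -meanZ; last exact: has_mean_sq.
apply: mean_le; last first.
- move=> x; rewrite exprVn; set y : R := 2 ^+ N.
  have y0 : 0 < y by rewrite exprn_gt0.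
  rewrite mulrC ler_pdivlMr//; case: (ltP y (W x)) => h1.
    by rewrite max_l ?subr_ge0 ?(ltW h1)//; nra.
  by rewrite max_r ?subr_le0// mul0r sqr_ge0.
- by apply: has_meanZ; exact: has_mean_sq.
exact: has_mean_excess.
Qed.

Let F (x : R) := fine (PW [set omega | W omega <= x]).

Let measurable_le (x : R) : measurable [set omega | W omega <= x].
Proof.
have -> : [set omega | W omega <= x] = W @^-1` `]-oo, x].
  by apply/seteqP; split => o /=; rewrite in_itv.
by rewrite -[_ @^-1` _]setTI; exact: measurable_funPT.
Qed.

Let F_nd : {homo F : x y / x <= y}.
Proof.
move=> x y xy; rewrite /F fine_le ?fin_num_measure//.
by apply: le_measure; rewrite ?inE//; move=> o /= Wx; exact: le_trans Wx xy.
Qed.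

Let indicator_ltE (a : R) : (fun o => (a < W o)%R%:R : R) = \1_(~` [set o | W o <= a]).
Proof.
apply/funext => o; rewrite indicE in_setC; congr (_ %:R).
case: ltP => h; last by rewrite mem_set.
by rewrite memNset//=; apply/negP; rewrite -ltNge.
Qed.

Lemma has_mean_indicator_lt (a : R) : has_mean PW (fun o => (a < W o)%R%:R).
Proof. by rewrite indicator_ltE; apply: has_mean_indic; exact: measurableC. Qed.

Lemma mean_indicator_lt (a : R) : mean PW (fun o => (a < W o)%R%:R) = 1 - F a.
Proof.
rewrite indicator_ltE mean_indic; last exact: measurableC.
rewrite probability_setC//.
by rewrite -[PW [set omega | W omega <= a]]fineK ?fin_num_measure.
Qed.

Variable w : forall n : nat, 'I_n -> R.
Arguments w : clear implicits.
Hypothesis w_gt0 : forall n (i : 'I_n), 0 < w n i.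
Hypothesis wreg : weight_regularity w W.

(** Empirical distribution functions of positive weights vanish left of 0, hence so does [F], first
    at continuity points and then by monotonicity. *)
Lemma weight_ge0 : {ae PW, forall x, 0 <= W x}.
Proof.
have Fneg x : x < 0 -> F x = 0.
  move=> x0; have [y [xy y0 yc]] := nondecreasing_continuity_point F_nd x0.
  have [_ /(_ y yc) wc _] := wreg.
  suff Fy0 : F y = 0.
    by apply/eqP; rewrite eq_le -[in X in X && _]Fy0 F_nd ?(ltW xy)// fine_ge0.
  have e0 : (fun n => empirical_cdf (w n) y) = fun=> 0.
    apply/funext => n; rewrite /empirical_cdf big1 ?mulr0// => i _.
    by rewrite leNgt (lt_trans y0).
  rewrite e0 in wc.
  exact: (cvg_unique _ wc (cvg_cst _)).
have sub : ~` [set x | 0 <= W x] `<=` \bigcup_k [set x | W x <= - k.+1%:R^-1].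
  move=> x /= /negP; rewrite -ltNge => /ltr_add_invr[k Wk]; exists k => //=.
  by rewrite -subr_le0 opprK ltW.
apply: (@negligibleS _ _ _ _ _ _ sub); apply: negligible_bigcup => k.
apply/negligibleP => //; apply/eqP.
rewrite -[X in X == _]fineK ?fin_num_measure// eqe; apply/eqP.
by apply: Fneg; rewrite oppr_lt0.
Qed.

(** Convergence in distribution alone does not control a linearly growing [g]. Step functions
    jumping at continuity points of [F] do converge; the remaining error is a mesh term plus the
    excess above [2^M], small uniformly in [n] by the tail bound and small for [W] by its second
    moment. *)
Lemma empirical_mean_cvg (g : R -> R) (L : R) :
  (forall x y, `|g x - g y| <= L * `|x - y|) ->
  empirical_mean (w n) g @[n --> \oo] --> mean PW (g \o W).
Proof.
move=> gL.
have L0 : 0 <= L.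
  by have := le_trans (normr_ge0 _) (gL 1 0); rewrite subr0 normr1 mulr1.
have [_ wc [c [tau [c0 tau2 tail]]]] := wreg.
apply/cvgrPdist_lt => e0 e0_gt0.
(* Both approximation errors are at most [2 L e <= e0 / 4], leaving [e0 / 2] for the step
   function. *)
pose e := e0 / (8 * (L + 1)).
have e_gt0 : 0 < e by rewrite divr_gt0// mulr_gt0// ltr_wpDl.
have Le : L * e <= e0 / 8.
  have -> : e0 / 8 = (L + 1) * e.
    by rewrite /e; field; rewrite gt_eqF// ltr_wpDl.
  by rewrite ler_wpM2r ?(ltW e_gt0)// lerDl.
(* One continuity point is taken from each interval []e (k - 1) / 2, e k / 2[]: consecutive points
   are less than [e] apart, and [a 0 < 0] lies below every weight. *)
have /choice[a aP] : forall k : nat, exists y,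
    [/\ e * k%:R / 2 - e / 2 < y, y < e * k%:R / 2 & {for y, continuous F}].
  move=> k; apply: nondecreasing_continuity_point => //.
  by rewrite ltrBlDr ltrDl divr_gt0.
have astep k : a k <= a k.+1 <= a k + e.
  have [a1 a2 _] := aP k; have [b1 b2 _] := aP k.+1.
  by move: b1 b2; rewrite -natr1 => b1 b2; apply/andP; split; lra.
have a0 : a 0%N < 0 by have [_] := aP 0%N; rewrite mulr0 mul0r.
have [M [HM1 HM2]] : exists M, (forall n, empirical_mean (w n)
    (fun x => Num.max (x - 2 ^+ M) 0) <= e) /\
    mean PW (fun x => Num.max (W x - 2 ^+ M) 0) <= e.
  near \oo => M; exists M; split; near: M; first exact: empirical_excess_cvg tail _ _.
  exact: excess_mean_cvg.
pose N := (Num.truncn (2 * 2 ^+ M / e)).+2.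
have aN : 2 ^+ M <= a N.
  have [aN _ _] := aP N; apply: ltW; apply: le_lt_trans aN.
  have h : 2 * 2 ^+ M / e <= N.-1%:R by apply/ltW; exact: truncnS_gt.
  rewrite ler_pdivrMr// in h.
  have -> : N%:R = N.-1%:R + 1 :> R by rewrite natr1.
  by lra.
pose s := step_fun g a N.
pose ex x : R := Num.max (x - 2 ^+ M) 0.
have approx x : 0 <= x -> `|g x - s x| <= L * e + L * ex x.
  move=> x0.
  have := step_fun_approx N L0 (ltW e_gt0) gL astep (lt_le_trans a0 x0).
  move=> /le_trans; apply.
  rewrite lerD2l ler_wpM2l// /ex ge_max !le_max lexx orbT andbT.
  by rewrite lerD2l lerN2 aN.
have sumex : has_mean PW (ex \o W) by exact: has_mean_excess.
have sums : has_mean PW (s \o W).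
  apply: has_meanD; first exact: has_mean_cst.
  by apply: has_mean_sum => k; apply: has_meanZ; exact: has_mean_indicator_lt.
have cs : empirical_mean (w n) s @[n --> \oo] --> mean PW (s \o W).
  have -> : mean PW (s \o W) =
      g (a 0%N) + \sum_(k < N) (g (a k.+1) - g (a k)) * (1 - F (a k)).
    rewrite meanD ?mean_cst; last 2 first.
    - exact: has_mean_cst.
    - by apply: has_mean_sum => k; apply: has_meanZ; exact: has_mean_indicator_lt.
    rewrite mean_sum => [|k]; last by apply: has_meanZ; exact: has_mean_indicator_lt.
    congr +%R; apply: eq_bigr => k _.
    by rewrite meanZ ?mean_indicator_lt//; exact: has_mean_indicator_lt.
  have : g (a 0%N) + \sum_(k < N) (g (a k.+1) - g (a k)) *
        (1 - empirical_cdf (w n) (a k)) @[n --> \oo] -->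
      g (a 0%N) + \sum_(k < N) (g (a k.+1) - g (a k)) * (1 - F (a k)).
    apply: cvgD; first exact: cvg_cst.
    apply: cvg_big => [|k _]; [exact: add_continuous|]; apply: cvgM; first exact: cvg_cst.
    by apply: cvgB; [exact: cvg_cst|apply: wc; have [] := aP k].
  apply: cvg_trans; apply: near_eq_cvg; near=> n.
  have n0 : (0 < n)%N by near: n; exact: nbhs_infty_gt.
  rewrite empirical_meanD empirical_mean_cst// empirical_mean_sum; congr +%R.
  by apply: eq_bigr => k _; rewrite empirical_meanZ empirical_mean_tail_ind.
have e02 : 0 < e0 / 2 by rewrite divr_gt0.
have meansg : `|mean PW (g \o W) - mean PW (s \o W)| <= L * e + L * e.
  rewrite -meanB//; last exact: has_mean_lipschitz gL.
  apply: (@le_trans _ _ (mean PW (fun x => L * e + L * ex (W x)))); last first.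
    rewrite meanD ?mean_cst ?meanZ//; last 2 first.
    - exact: has_mean_cst.
    - exact: has_meanZ.
    by rewrite lerD2l ler_wpM2l.
  have sumL : has_mean PW (fun x => L * e + L * ex (W x)).
    by apply: has_meanD; [exact: has_mean_cst|exact: has_meanZ].
  have sumB : has_mean PW (fun x => g (W x) - s (W x)).
    by apply: has_meanB => //; exact: has_mean_lipschitz gL.
  rewrite ler_norml lerNl -mulN1r -meanZ//; apply/andP; split;
    apply: ae_mean_le => //; [exact: has_meanZ| |];
    apply: filterS weight_ge0 => x /approx; rewrite ler_norml => /andP[];
    rewrite /=; lra.
near=> n.
have n0 : (0 < n)%N by near: n; exact: nbhs_infty_gt.
have h1 : `|mean PW (s \o W) - empirical_mean (w n) s| < e0 / 2.
  by near: n; move/cvgrPdist_lt : cs => /(_ _ e02).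
have h2 : `|empirical_mean (w n) g - empirical_mean (w n) s| <= L * e + L * e.
  have sub : empirical_mean (w n) g - empirical_mean (w n) s =
      empirical_mean (w n) (fun x => g x - s x).
    by rewrite /empirical_mean sumrB mulrBr.
  rewrite sub (@le_trans _ _ (empirical_mean (w n) (fun x => `|g x - s x|)))//.
    rewrite /empirical_mean normrM ger0_norm ?invr_ge0// ler_wpM2l ?invr_ge0//.
    exact: ler_norm_sum.
  apply: (@le_trans _ _ (empirical_mean (w n) (fun x => L * e + L * ex x))).
    by apply: empirical_mean_le => i; apply: approx; exact: ltW.
  by rewrite empirical_meanD empirical_mean_cst// empirical_meanZ lerD2l ler_wpM2l// HM1.
move: meansg h1 h2; rewrite !ler_norml !ltr_norml.
by move=> /andP[? ?] /andP[? ?] /andP[? ?]; apply/andP; split; lra.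
Unshelve. all: by end_near. Qed.

End LimitWeight.

(** * Comparison with the mean-field energy *)

Section Energy.
Context {R : realType} {n : nat}.
Variables (w : 'I_n -> R) (b : R).
Hypotheses (w_gt0 : forall i, 0 < w i) (n_gt0 : (0 < n)%N) (b_gt0 : 0 < b).

Let l := total_weight w.

Lemma total_weight_gt0 : 0 < total_weight w.
Proof.
case: n w w_gt0 n_gt0 => // m v v0 _; rewrite /total_weight big_ord_recl.
by rewrite ltr_wpDr// sumr_ge0// => i _; rewrite ltW.
Qed.

Definition log_edge (i j : 'I_n) : R := ln (1 + b * rank1_prob w i j).

(** The edge probability is [u / (1 + u)], so [log_edge] agrees with [b u] up to second order in
    [u]. *)
Let u (i j : 'I_n) : R := w i * w j / l.

Let u_gt0 i j : 0 < u i j.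
Proof. by rewrite divr_gt0 ?mulr_gt0 ?total_weight_gt0. Qed.

Let probE i j : rank1_prob w i j = u i j / (1 + u i j).
Proof.
have l0 := total_weight_gt0; have ww : 0 < w i * w j by rewrite mulr_gt0.
by rewrite /rank1_prob /u /l; field; rewrite !gt_eqF ?addr_gt0.
Qed.

Lemma rank1_prob_ge0 i j : 0 <= rank1_prob w i j.
Proof. by rewrite probE divr_ge0 ?addr_ge0 ?ltW. Qed.

Lemma log_edge_ge0 i j : 0 <= log_edge i j.
Proof. by rewrite ln_ge0// lerDl mulr_ge0 ?rank1_prob_ge0 ?ltW. Qed.

Lemma log_edgeC i j : log_edge i j = log_edge j i.
Proof. by rewrite /log_edge /rank1_prob [w j * _]mulrC. Qed.

Let log_edge_le i j : log_edge i j <= b * u i j.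
Proof.
have u0 := u_gt0 i j.
apply: (@le_trans _ _ (b * rank1_prob w i j)).
  by rewrite le_ln1Dx// (lt_le_trans (ltrN10 R))// mulr_ge0 ?rank1_prob_ge0 ?ltW.
rewrite ler_pM2l// probE ler_pdivrMr ?addr_gt0//; nra.
Qed.

(* [ln (1 + y) >= y / (1 + y)], from [ln (1 / (1 + y)) <= 1 / (1 + y) - 1]. *)
Let log_edge_gap i j (m : R) : 0 <= m -> (u i j <= m \/ 1 <= m) ->
  b * u i j - log_edge i j <= b * (1 + b) * (u i j * m).
Proof.
move=> m0 um; have u0 := u_gt0 i j; set x := u i j in um u0 *.
have y0 : 0 < 1 + b * rank1_prob w i j.
  by rewrite ltr_pwDl// mulr_ge0 ?rank1_prob_ge0 ?ltW.
have bx0 : 0 < 1 + (1 + b) * x by rewrite addr_gt0// mulr_gt0// addr_gt0.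
have : b * x / (1 + (1 + b) * x) <= log_edge i j.
  have h : ln (1 + b * rank1_prob w i j)^-1 <= (1 + b * rank1_prob w i j)^-1 - 1.
    rewrite -[X in ln X](subrK 1) addrC le_ln1Dx//.
    by rewrite ltrBrDr addNr invr_gt0.
  move: h; rewrite lnV ?posrE// lerNl; apply: le_trans.
  rewrite probE -/x opprB le_eqVlt; apply/orP; left; apply/eqP.
  have bx : 0 < b * x by rewrite mulr_gt0.
  by field; rewrite !gt_eqF ?addr_gt0.
move=> h; apply: (@le_trans _ _ (b * x - b * x / (1 + (1 + b) * x))).
  by rewrite lerB.
have -> : b * x - b * x / (1 + (1 + b) * x) =
    b * (1 + b) * x * (x / (1 + (1 + b) * x)).
  by field; rewrite gt_eqF.
have c0 : 0 <= b * (1 + b) * x.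
  by rewrite mulr_ge0 ?(ltW u0)// mulr_ge0 ?(ltW b_gt0)// addr_ge0 ?(ltW b_gt0).
rewrite [X in _ <= X]mulrA ler_wpM2l//.
rewrite ler_pdivrMr// mulrDr mulr1.
have mx : 0 <= m * x by rewrite mulr_ge0// ltW.
have mbx : 0 <= b * (m * x) by rewrite mulr_ge0// ltW.
have -> : m + m * ((1 + b) * x) = m + (m * x + b * (m * x)) by ring.
case: um => um; first by rewrite (le_trans um)// lerDl addr_ge0.
rewrite (@le_trans _ _ (m * x))//; first by rewrite ler_pMl.
by rewrite addrCA lerDl addr_ge0.
Qed.

Lemma sum_pairs (f : 'I_n -> 'I_n -> R) : (forall i j, f i j = f j i) ->
  \sum_i \sum_j f i j =
  2 * \sum_(e : 'I_n * 'I_n | (e.1 < e.2)%N) f e.1 e.2 + \sum_i f i i.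
Proof.
move=> fC; rewrite pair_bigA/=.
rewrite (bigID (fun e : 'I_n * 'I_n => (e.1 < e.2)%N))/= mulrDl mul1r -addrA.
congr +%R; rewrite (bigID (fun e : 'I_n * 'I_n => (e.2 < e.1)%N))/=; congr +%R.
  rewrite (reindex_inj (h := fun e : 'I_n * 'I_n => (e.2, e.1)))/=; last first.
    by move=> [? ?] [? ?] [-> ->].
  by apply: eq_big => [[i j]/=|[i j] _/=]; [rewrite -leqNgt andb_idl// => /ltnW|].
transitivity (\sum_(e : 'I_n * 'I_n | e.1 == e.2) f e.1 e.2).
  by apply: eq_bigl => -[i j] /=; rewrite -!leqNgt -eqn_leq eq_sym.
rewrite -(pair_big_dep xpredT (fun i j => i == j) f)/=.
by apply: eq_bigr => i _; rewrite (big_pred1 i)// => j; rewrite eq_sym.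
Qed.

(** Every pair is charged, whatever its colours, so the error is uniform in the configuration. The
    last sum is the diagonal, present in the squared colour weights but absent from the graph;
    [2^-1] compensates for ordered pairs. *)
Definition energy_error : R :=
  2^-1 * (\sum_i \sum_j (b * u i j - log_edge i j) + \sum_i log_edge i i).

Variable K : finType.
Implicit Type s : {ffun 'I_n -> K}.

Definition color_weight s (k : K) : R :=
  \sum_(i < n | s i == k) w i.

Definition edge_energy s : R :=
  \sum_(e : 'I_n * 'I_n | (e.1 < e.2)%N) (s e.1 == s e.2)%:R * log_edge e.1 e.2.

Let sum_same s : \sum_i \sum_j (s i == s j)%:R * (b * u i j) =
  b / l * \sum_k color_weight s k ^+ 2.
Proof.
have -> : \sum_k color_weight s k ^+ 2 = \sum_i w i * color_weight s (s i).
  rewrite (partition_big s xpredT)//=; apply: eq_bigr => k _.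
  rewrite expr2 {1}/color_weight mulr_suml.
  by rewrite [RHS](eq_bigr (fun i => w i * color_weight s k))// => i /eqP ->.
rewrite mulr_sumr; apply: eq_bigr => i _.
rewrite /color_weight [in RHS]big_mkcond/= !mulr_sumr; apply: eq_bigr => j _.
rewrite [s j == _]eq_sym /u; case: eqP => _; rewrite ?mul0r ?mulr0// mul1r.
by rewrite mulrA; ring.
Qed.

Let energyE s : edge_energy s = 2^-1 *
  (\sum_i \sum_j (s i == s j)%:R * log_edge i j - \sum_i log_edge i i).
Proof.
rewrite (sum_pairs (f := fun i j => (s i == s j)%:R * log_edge i j)); last first.
  by move=> i j; rewrite eq_sym log_edgeC.
have -> : \sum_i (s i == s i)%:R * log_edge i i = \sum_i log_edge i i.
  by apply: eq_bigr => i _; rewrite eqxx mul1r.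
by rewrite addrK mulKf.
Qed.

(** Dropping the diagonal and bounding [log_edge] by [b u] go in the same direction, so the upper
    bound carries no error term. *)
Lemma edge_energy_le s :
  edge_energy s <= b / (2 * l) * \sum_k color_weight s k ^+ 2.
Proof.
have -> : b / (2 * l) = 2^-1 * (b / l).
  by field; rewrite gt_eqF// total_weight_gt0.
rewrite energyE -mulrA ler_wpM2l ?invr_ge0// -sum_same lerBlDr ler_wpDr//.
  by rewrite sumr_ge0// => i _; exact: log_edge_ge0.
by apply: ler_sum => i _; apply: ler_sum => j _; rewrite ler_wpM2l.
Qed.

Lemma edge_energy_ge s :
  b / (2 * l) * (\sum_k color_weight s k ^+ 2) - energy_error <= edge_energy s.
Proof.
have -> : b / (2 * l) = 2^-1 * (b / l).
  by field; rewrite gt_eqF// total_weight_gt0.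
rewrite energyE /energy_error -mulrA -mulrBr ler_wpM2l ?invr_ge0// -sum_same.
rewrite opprD addrA lerD2r -sumrB; apply: ler_sum => i _.
rewrite -sumrB; apply: ler_sum => j _; case: eqP => _; first by rewrite !mul1r; lra.
by rewrite !mul0r sub0r oppr_le0 subr_ge0.
Qed.

(** A weight above [2 C] is at most twice its excess, which settles the pairs containing one; for
    the others [u <= 4 C^2 / l] and the gap is quadratic in [u]. As the weights sum to [l], dividing
    by [n] leaves terms of order [1 / n] and multiples of the mean excess. *)
Lemma energy_error_le (C : R) (ex := fun x : R => Num.max (x - C) 0) : 0 <= C ->
  energy_error <=
    b * (1 + b) * (2 * C ^+ 2 + 2 * \sum_i ex (w i)) + b * (C + \sum_i ex (w i)).
Proof.
move=> C0; set S := \sum_i ex (w i).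
have ex0 x : 0 <= ex x by rewrite /ex le_max lexx orbT.
have exle x : x <= C + ex x by rewrite -lerBlDl /ex le_max lexx.
have l0 : 0 < l by exact: total_weight_gt0.
have bb0 : 0 < b * (1 + b) by rewrite mulr_gt0// addr_gt0.
have gap i j : b * u i j - log_edge i j <= b * (1 + b) *
    (u i j * (4 * C ^+ 2 / l) + w j / l * (2 * ex (w i)) + w i / l * (2 * ex (w j))).
  have wi := w_gt0 i; have wj := w_gt0 j.
  have t1 : 0 <= u i j * (4 * C ^+ 2 / l).
    by rewrite mulr_ge0 ?(ltW (u_gt0 i j))// divr_ge0 ?(ltW l0)// mulr_ge0 ?sqr_ge0.
  have t2 i' j' : 0 <= w j' / l * (2 * ex (w i')).
    by rewrite mulr_ge0 ?divr_ge0 ?(ltW l0) ?(ltW (w_gt0 j'))// mulr_ge0.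
  have big i' j' : 2 * C < w i' -> u i' j' <= w j' / l * (2 * ex (w i')).
    move=> h; have -> : u i' j' = w j' / l * w i' by rewrite /u; ring.
    rewrite ler_wpM2l ?divr_ge0 ?(ltW (w_gt0 j')) ?(ltW l0)//.
    by have := exle (w i'); lra.
  have trivial_gap : b * u i j - log_edge i j <= b * (1 + b) * (u i j * 1).
    by apply: log_edge_gap => //; right.
  have [hi|hi] := ltP (2 * C) (w i).
    rewrite (le_trans trivial_gap)// ler_wpM2l ?(ltW bb0)// mulr1.
    by have := big _ j hi; have := t2 j i; lra.
  have [hj|hj] := ltP (2 * C) (w j).
    rewrite (le_trans trivial_gap)// ler_wpM2l ?(ltW bb0)// mulr1.
    have := big _ i hj; rewrite /u [w j * w i]mulrC => ?.
    by have := t2 i j; rewrite /u in t1 *; lra.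
  have hu : u i j <= 4 * C ^+ 2 / l.
    by rewrite ler_wpM2r ?invr_ge0 ?(ltW l0)//; nra.
  rewrite (le_trans (log_edge_gap _ (or_introl hu)))//.
    by rewrite divr_ge0 ?(ltW l0)// mulr_ge0 ?sqr_ge0.
  by rewrite ler_wpM2l ?(ltW bb0)//; have := t2 i j; have := t2 j i; lra.
have sumw : \sum_i w i = l by [].
have sum1 : \sum_i \sum_j (b * u i j - log_edge i j) <=
    b * (1 + b) * (4 * C ^+ 2 + 4 * S).
  apply: (@le_trans _ _ (\sum_i \sum_j b * (1 + b) *
    (u i j * (4 * C ^+ 2 / l) + w j / l * (2 * ex (w i)) + w i / l * (2 * ex (w j))))).
    by apply: ler_sum => i _; apply: ler_sum => j _.
  have -> : 4 * C ^+ 2 + 4 * S =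
      \sum_i (w i * (4 * C ^+ 2 / l) + 2 * ex (w i) + w i / l * (2 * S)).
    rewrite !big_split/= -!mulr_suml -mulr_sumr sumw -/S.
    by field; rewrite gt_eqF.
  rewrite mulr_sumr; apply: ler_sum => i _.
  rewrite -mulr_sumr ler_wpM2l ?(ltW bb0)// !big_split/=.
  have sumu : \sum_j u i j = w i.
    by rewrite /u -mulr_suml -mulr_sumr sumw mulfK// gt_eqF.
  rewrite -mulr_suml sumu -!mulr_suml -!mulr_sumr sumw -/S.
  by rewrite le_eqVlt; apply/orP; left; apply/eqP; field; rewrite gt_eqF.
have sum2 : \sum_i log_edge i i <= b * (C + S).
  have wS i : w i <= C + S.
    rewrite (le_trans (exle _))// lerD2l /S (bigD1 i)//= lerDl sumr_ge0//.
  apply: (@le_trans _ _ (\sum_i b * (w i / l * (C + S)))).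
    apply: ler_sum => i _; rewrite (le_trans (log_edge_le _ _))// ler_wpM2l ?(ltW b_gt0)//.
    by rewrite /u mulrAC ler_wpM2l// divr_ge0 ?(ltW l0) ?(ltW (w_gt0 i)).
  rewrite -mulr_sumr -!mulr_suml sumw divff ?mul1r// gt_eqF//.
have bCS : 0 <= b * (C + S).
  by rewrite mulr_ge0 ?(ltW b_gt0)// addr_ge0// sumr_ge0.
by rewrite /energy_error; lra.
Qed.

End Energy.

(** * The limiting pressure *)

Section MeanFieldBounds.
Context {R : realType} {q : nat} (k1 : 'I_q) {n : nat}.
Variables (w : 'I_n -> R) (b B : R).
Hypotheses (w_gt0 : forall i, 0 < w i) (n_gt0 : (0 < n)%N) (b_gt0 : 0 < b).

Definition mean_field (b B : R) (z : 'I_q -> R) (x : R) (k : 'I_q) : R :=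
  field1 k1 B k + b * x * z k.

Definition mean_field_log (b B : R) (z : 'I_q -> R) (x : R) : R :=
  lse (mean_field b B z x).

Definition energy (s : {ffun 'I_n -> 'I_q}) : R :=
  \sum_i field1 k1 B (s i) + edge_energy w b s.

Let l := total_weight w.

(** Each [S_k ^ 2] has been replaced by its tangent at [l z_k], and the spins have been summed
    out. *)
Definition mean_field_value (z : 'I_q -> R) : R :=
  \sum_i mean_field_log b B z (w i) - b * l / 2 * \sum_k z k ^+ 2.

Let l0 : 0 < l. Proof. exact: total_weight_gt0. Qed.

Let sum_mean_field (z : 'I_q -> R) (s : {ffun 'I_n -> 'I_q}) :
  \sum_i mean_field b B z (w i) (s i) =
  \sum_i field1 k1 B (s i) + b * \sum_k color_weight w s k * z k.
Proof.
rewrite big_split/=; congr +%R; rewrite mulr_sumr.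
rewrite (partition_big s xpredT)//=; apply: eq_bigr => k _.
rewrite /color_weight mulr_suml mulr_sumr; apply: eq_bigr => i /eqP ->.
by rewrite mulrA.
Qed.

Let square_ge (S z : R) : b * (S * z) - b * l / 2 * z ^+ 2 <= b / (2 * l) * S ^+ 2.
Proof.
rewrite -subr_ge0.
have -> : b / (2 * l) * S ^+ 2 - (b * (S * z) - b * l / 2 * z ^+ 2) =
    b / (2 * l) * (S - l * z) ^+ 2 by field; rewrite gt_eqF.
by rewrite mulr_ge0 ?sqr_ge0// divr_ge0 ?(ltW b_gt0)// mulr_ge0 ?(ltW l0).
Qed.

Lemma lse_energy_ge (z : 'I_q -> R) :
  mean_field_value z - energy_error w b <= lse energy.
Proof.
have -> : mean_field_value z - energy_error w b =
    lse (fun s : {ffun 'I_n -> 'I_q} => \sum_i mean_field b B z (w i) (s i) +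
      (- (b * l / 2 * \sum_k z k ^+ 2) - energy_error w b)).
  rewrite (lseD [ffun=> k1]) addrA; congr (_ - _ - _).
  exact/esym/(lse_ffun k1).
apply: (le_lse [ffun=> k1]) => s; rewrite sum_mean_field /energy.
rewrite -addrA lerD2l; apply: le_trans (edge_energy_ge w_gt0 n_gt0 b_gt0 s).
have := square_ge; rewrite addrA lerD2r -/l.
set c1 := b * l / 2; set c2 := b / (2 * l) => sq.
by rewrite !mulr_sumr -sumrB; apply: ler_sum => k _.
Qed.

(** Rounding the shares [S_k / l] down to multiples of [1 / M] selects a [t] depending on the
    configuration. The tangent there misses the mean-field energy by [b l / 2] times a squared
    rounding error, at most [M^-2] per colour. Summing over all [t] removes the dependence. *)
Lemma sum_expR_energy_le (M : nat) : (0 < M)%N ->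
  \sum_s expR (energy s) <= \sum_(t : {ffun 'I_q -> 'I_M.+1})
    expR (mean_field_value (fun k => (t k)%:R / M%:R)
          + b * l * q%:R / (2 * M%:R ^+ 2)).
Proof.
move=> M0; have M0' : 0 < M%:R :> R by rewrite ltr0n.
pose z (t : {ffun 'I_q -> 'I_M.+1}) k : R := (t k)%:R / M%:R.
pose c : R := b * l * q%:R / (2 * M%:R ^+ 2).
pose G (t : {ffun 'I_q -> 'I_M.+1}) (s : {ffun 'I_n -> 'I_q}) : R :=
  \sum_i mean_field b B (z t) (w i) (s i) + (- (b * l / 2 * \sum_k z t k ^+ 2) + c).
suff H s : exists t, energy s <= G t s.
  apply: (@le_trans _ _ (\sum_s \sum_t expR (G t s))).
    apply: ler_sum => s _; have [t ht] := H s.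
    rewrite (bigD1 t)//=; apply: ler_wpDr; last by rewrite ler_expR.
    by apply: sumr_ge0 => t' _; exact: expR_ge0.
  rewrite exchange_big; apply: ler_sum => t _.
  rewrite le_eqVlt; apply/orP; left; apply/eqP.
  transitivity ((\sum_(s : {ffun 'I_n -> 'I_q})
      expR (\sum_i mean_field b B (z t) (w i) (s i))) *
      expR (- (b * l / 2 * \sum_k z t k ^+ 2) + c)).
    by rewrite mulr_suml; apply: eq_bigr => s _; rewrite -expRD.
  rewrite /mean_field_value -addrA [in RHS]expRD; congr (_ * _).
  exact: (sum_ffun_expR k1 (fun i => mean_field b B (z t) (w i))).
have S01 k : 0 <= color_weight w s k / l <= 1.
  have cw0 : 0 <= color_weight w s k by apply: sumr_ge0 => i _; exact: ltW.
  rewrite divr_ge0 ?(ltW l0)//= ler_pdivrMr// mul1r /l /total_weight [leRHS](bigID (fun i => s i == k))/=.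
  by rewrite lerDl sumr_ge0// => i _; rewrite ltW.
pose t : {ffun 'I_q -> 'I_M.+1} :=
  [ffun k => inord (Num.truncn (M%:R * (color_weight w s k / l)))].
have tE k : `|color_weight w s k / l - z t k| <= M%:R^-1.
  have /andP[x0 x1] := S01 k; set x := _ / l in x0 x1 *.
  have Mx0 : 0 <= M%:R * x by rewrite mulr_ge0.
  have /andP[h1 h2] := truncn_itv Mx0.
  have trM : (Num.truncn (M%:R * x) < M.+1)%N.
    by rewrite ltnS -(ler_nat R) (le_trans h1)// ler_piMr// ltW.
  rewrite /z /t ffunE inordK//.
  rewrite -(@ler_pM2l _ M%:R)// mulfV ?gt_eqF//.
  rewrite -[X in X * _](ger0_norm (ltW M0')) -normrM.
  have -> : M%:R * (x - (Num.truncn (M%:R * x))%:R / M%:R) =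
      M%:R * x - (Num.truncn (M%:R * x))%:R by field; rewrite gt_eqF.
  rewrite ger0_norm ?subr_ge0// lerBlDl.
  by move: h2; rewrite -natr1 => /ltW.
exists t; rewrite /G sum_mean_field /energy -!addrA lerD2l.
apply: (le_trans (edge_energy_le w_gt0 n_gt0 b_gt0 s)); rewrite -/l.
have -> : c = \sum_(k < q) b * l / 2 * M%:R^-1 ^+ 2.
  rewrite sumr_const card_ord -mulr_natl /c.
  by field; rewrite gt_eqF.
set c1 := b * l / 2; set c2 := b / (2 * l).
rewrite addrA !mulr_sumr -sumrB -big_split/=; apply: ler_sum => k _.
rewrite {}/c1 {}/c2; have := tE k; set S := color_weight w s k; set y := z t k => h.
have -> : b / (2 * l) * S ^+ 2 = b * (S * y) - b * l / 2 * y ^+ 2 +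
    b * l / 2 * (S / l - y) ^+ 2 by field; rewrite gt_eqF.
rewrite lerD2l ler_wpM2l//; first by rewrite !mulr_ge0 ?invr_ge0 ?(ltW b_gt0) ?(ltW l0).
by rewrite -real_normK ?num_real// lerXn2r// nnegrE invr_ge0.
Qed.

End MeanFieldBounds.

Section Pressure.
Context {R : realType} {q : nat} (k1 : 'I_q).
Variable w : forall n : nat, 'I_n -> R.
Arguments w : clear implicits.
Context {d : nat -> measure_display} {T : forall n, measurableType (d n)}.
Variables (P : forall n, probability (T n) R).
Variable I : forall n, 'I_n -> 'I_n -> {RV (P n) >-> bool}.
Context {dW : measure_display} {TW : measurableType dW}.
Variables (PW : probability TW R) (W : {RV PW >-> R}).
Hypothesis w_gt0 : forall n (i : 'I_n), 0 < w n i.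
Hypothesis graph : forall n, rank1_graph (w n) (@I n).
Hypothesis wreg : weight_regularity w W.
Hypothesis W2 : ('E_PW[(fun omega => W omega ^+ 2)%R] < +oo)%E.
Variable beta : R.
Hypothesis beta_gt0 : 0 < beta.

Lemma beta'_gt0 : 0 < beta' beta.
Proof. by rewrite subr_gt0 expR_gt1. Qed.

Let b := beta' beta.

Lemma annealed_weight_energy n B (s : {ffun 'I_n -> 'I_q}) : (0 < n)%N ->
  annealed_weight k1 (@I n) beta B s = expR (energy k1 (w n) b B s).
Proof.
move=> n0; rewrite (annealed_weightE k1 beta B s (graph n)) expRD; congr *%R.
rewrite expR_sum; apply: eq_bigr => -[i j] _ /=.
case: eqP => _; last by rewrite mulr0 !mul0r addr0 expR0.
rewrite mulr1 mul1r /log_edge lnK// posrE ltr_wpDr// mulr_ge0 ?(ltW beta'_gt0)//.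
exact: rank1_prob_ge0.
Qed.

Let natV_cvg (c : R) : n%:R^-1 * c @[n --> \oo] --> (0 : R).
Proof.
have h : n%:R^-1 @[n --> \oo] --> (0 : R).
  by rewrite -(cvg_shiftS (fun n => n%:R^-1 : R)); exact: cvg_harmonic.
have <- : 0 * c = 0 by rewrite mul0r.
by apply: cvgM => //; exact: cvg_cst.
Qed.

Lemma energy_error_cvg (e : R) : 0 < e ->
  \forall n \near \oo, n%:R^-1 * energy_error (w n) b <= e.
Proof.
move=> e0; have b0 := beta'_gt0; rewrite -/b in b0.
have [_ _ [c [tau [c0 tau2 tail]]]] := wreg.
pose c1 := b * (1 + b) * 2 + b.
have c10 : 0 < c1 by rewrite addr_gt0// !mulr_gt0// addr_gt0.
have d0 : 0 < e / 2 / c1 by rewrite !divr_gt0.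
have [N hN] : exists N, forall n, empirical_mean (w n)
    (fun x => Num.max (x - 2 ^+ N) 0) <= e / 2 / c1.
  by have [N _ hN] := empirical_excess_cvg c0 tau2 tail d0; exists N; exact: hN N (leqnn N).
pose C : R := 2 ^+ N; have C0 : 0 <= C by rewrite exprn_ge0.
pose c2 := b * (1 + b) * (2 * C ^+ 2) + b * C.
have e20 : 0 < e / 2 by rewrite divr_gt0.
near=> n.
have n0 : (0 < n)%N by near: n; exact: nbhs_infty_gt.
have hc2 : n%:R^-1 * c2 <= e / 2.
  near: n; have /cvgrPdist_le /(_ _ e20) := natV_cvg c2; apply: filterS => n.
  by rewrite sub0r normrN; apply: le_trans; exact: ler_norm.
have h := energy_error_le (w_gt0 (n := n)) n0 b0 C0.
apply: (@le_trans _ _ (n%:R^-1 * c2 + c1 * empirical_mean (w n)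
    (fun x => Num.max (x - C) 0))).
  rewrite /empirical_mean [c1 * _]mulrCA -mulrDr ler_wpM2l ?invr_ge0// (le_trans h)//.
  by rewrite le_eqVlt; apply/orP; left; apply/eqP; rewrite /c2 /c1; ring.
have := hN n; rewrite ler_pdivlMr// mulrC => h2.
by rewrite [leRHS](splitr e) lerD.
Unshelve. all: by end_near. Qed.

Definition mean_field_functional (B : R) (z : 'I_q -> R) : R :=
  mean PW (mean_field_log k1 b B z \o W)
  - b * mean PW W / 2 * \sum_k z k ^+ 2.

Lemma mean_field_log_lipschitz B z x y :
  `|mean_field_log k1 b B z x - mean_field_log k1 b B z y| <=
  b * (\sum_k `|z k|) * `|x - y|.
Proof.
apply: (lse_lipschitz k1) => k; rewrite /mean_field.
have -> : field1 k1 B k + b * x * z k - (field1 k1 B k + b * y * z k) =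
  b * z k * (x - y) by ring.
rewrite !normrM ler_wpM2r// (ger0_norm (ltW beta'_gt0)) ler_wpM2l ?(ltW beta'_gt0)//.
by rewrite (bigD1 k)//= lerDl sumr_ge0.
Qed.

Let weight_mean_cvg : n%:R^-1 * total_weight (w n) @[n --> \oo] --> mean PW W.
Proof.
by apply: (empirical_mean_cvg W2 w_gt0 wreg (g := id) (L := 1)) => x y; rewrite mul1r.
Qed.

Lemma mean_field_value_cvg B z :
  n%:R^-1 * mean_field_value k1 (w n) b B z @[n --> \oo] -->
  mean_field_functional B z.
Proof.
have -> : (fun n => n%:R^-1 * mean_field_value k1 (w n) b B z) =
  (fun n => empirical_mean (w n) (mean_field_log k1 b B z) -
     b / 2 * (\sum_k z k ^+ 2) * (n%:R^-1 * total_weight (w n))).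
  by apply/funext => n; rewrite /mean_field_value /empirical_mean; ring.
have -> : mean_field_functional B z = mean PW (mean_field_log k1 b B z \o W)
  - b / 2 * (\sum_k z k ^+ 2) * mean PW W.
  by rewrite /mean_field_functional; ring.
apply: cvgB.
  exact: (empirical_mean_cvg W2 w_gt0 wreg (mean_field_log_lipschitz B z)).
by apply: cvgM => //; exact: cvg_cst.
Qed.

Definition finite_pressure n B : R :=
  n%:R^-1 * ln (annealed_partition k1 (@I n) beta B).

Lemma partitionE n B : (0 < n)%N ->
  annealed_partition k1 (@I n) beta B = \sum_s expR (energy k1 (w n) b B s).
Proof. by move=> n0; apply: eq_bigr => s _; exact: annealed_weight_energy. Qed.

Lemma finite_pressure_ge B z (e : R) : 0 < e ->
  \forall n \near \oo, mean_field_functional B z - e <= finite_pressure n B.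
Proof.
move=> e0; have e2 : 0 < e / 2 by rewrite divr_gt0.
near=> n.
have n0 : (0 < n)%N by near: n; exact: nbhs_infty_gt.
have h1 : n%:R^-1 * energy_error (w n) b <= e / 2.
  by near: n; exact: energy_error_cvg.
have h2 : `|mean_field_functional B z - n%:R^-1 * mean_field_value k1 (w n) b B z| <= e / 2.
  by near: n; have /cvgrPdist_le := @mean_field_value_cvg B z; exact.
apply: (@le_trans _ _ (n%:R^-1 * (mean_field_value k1 (w n) b B z - energy_error (w n) b))).
  by rewrite mulrBr; have := le_trans (ler_norm _) h2; lra.
rewrite /finite_pressure ler_wpM2l ?invr_ge0// partitionE//.
exact: (lse_energy_ge k1 B (w_gt0 (n := n)) n0 beta'_gt0).
Unshelve. all: by end_near. Qed.

Lemma finite_pressure_le B V (e : R) : 0 < e ->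
  (forall z, (forall k, 0 <= z k <= 1) -> mean_field_functional B z <= V) ->
  \forall n \near \oo, finite_pressure n B <= V + e.
Proof.
move=> e0 zV; have b0 := beta'_gt0; rewrite -/b in b0.
have e4 : 0 < e / 4 by rewrite divr_gt0.
pose m := mean PW W.
(* [m + 1] eventually bounds the mean weight, so this [M] keeps the rounding cost per vertex at most
   [e / 4]. *)
pose M := (Num.truncn (`|b * (m + 1) * q%:R / 2 / (e / 4)|)).+1.
have M0 : 0 < M%:R :> R by rewrite ltr0n.
have hM : b * (m + 1) * q%:R / (2 * M%:R ^+ 2) <= e / 4.
  apply: (@le_trans _ _ (b * (m + 1) * q%:R / 2 / M%:R ^+ 2)).
    by rewrite invfM mulrA.
  have h : b * (m + 1) * q%:R / 2 / (e / 4) <= M%:R.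
    by rewrite (le_trans (ler_norm _))// ltW// truncnS_gt.
  have M2 : M%:R <= M%:R ^+ 2 :> R by rewrite expr2 ler_pMl// ler1n.
  rewrite ler_pdivrMr ?exprn_gt0//; rewrite ler_pdivrMr// mulrC in h.
  by rewrite mulrC (le_trans h)// mulrC ler_wpM2l// ltW.
pose z (t : {ffun 'I_q -> 'I_M.+1}) k : R := (t k)%:R / M%:R.
have zmax t : mean_field_functional B (z t) <= V.
  apply: zV => k; rewrite /z divr_ge0//= ler_pdivrMr// mul1r ler_nat.
  by rewrite -ltnS.
(* The number of grid points; [M] is fixed before [n], so [ln N / n] vanishes. *)
pose N : R := \sum_(t : {ffun 'I_q -> 'I_M.+1}) 1.
have N0 : 0 < N.
  by rewrite /N (bigD1 [ffun=> ord0])//= ltr_wpDr// sumr_ge0.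
have near_t : \forall n \near \oo,
    forall t, n%:R^-1 * mean_field_value k1 (w n) b B (z t) <= V + e / 4.
  apply: filter_forall => t.
  have /cvgrPdist_le /(_ _ e4) := @mean_field_value_cvg B (z t).
  apply: filterS => n; rewrite distrC => h.
  by have := le_trans (ler_norm _) h; have := zmax t; lra.
near=> n.
have n0 : (0 < n)%N by near: n; exact: nbhs_infty_gt.
have n0' : 0 < n%:R :> R by rewrite ltr0n.
have h1 : n%:R^-1 * ln N <= e / 4.
  near: n; have /cvgrPdist_le /(_ _ e4) := natV_cvg (ln N); apply: filterS => n.
  by rewrite sub0r normrN; apply: le_trans; exact: ler_norm.
have h2 t : n%:R^-1 * mean_field_value k1 (w n) b B (z t) <= V + e / 4.
  by move: t; near: n.
have h3 : n%:R^-1 * total_weight (w n) <= m + 1.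
  near: n; have /cvgrPdist_le /(_ _ ltr01) := weight_mean_cvg; apply: filterS => n.
  by rewrite distrC /m => h; have := le_trans (ler_norm _) h; lra.
rewrite /finite_pressure partitionE// mulrC ler_pdivrMr//.
apply: (@le_trans _ _ (ln (N * expR ((V + e / 4 + e / 4) * n%:R)))); last first.
  rewrite lnM ?posrE ?expR_gt0// expRK.
  have en : 0 <= e * n%:R by rewrite mulr_ge0// ltW.
  by move: h1; rewrite mulrC ler_pdivrMr//; lra.
rewrite ler_ln ?posrE ?mulr_gt0 ?expR_gt0//; last exact: (sum_expR_gt0 [ffun=> k1]).
apply: (le_trans (sum_expR_energy_le k1 B (w_gt0 (n := n)) n0 b0 (ltn0Sn _))).
rewrite /N mulr_suml; apply: ler_sum => t _; rewrite mul1r ler_expR -ler_pdivrMr//.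
rewrite mulrDl mulrC lerD//; first exact: h2.
apply: (le_trans _ hM).
have -> : b * total_weight (w n) * q%:R / (2 * M%:R ^+ 2) / n%:R =
  b * q%:R / (2 * M%:R ^+ 2) * (n%:R^-1 * total_weight (w n)).
  by rewrite [_ / _ / n%:R]mulrC; ring.
rewrite [leRHS](_ : _ = b * q%:R / (2 * M%:R ^+ 2) * (m + 1)); last ring.
by rewrite ler_wpM2l// divr_ge0 ?mulr_ge0 ?(ltW b0)// exprn_ge0// ltW.
Unshelve. all: by end_near. Qed.

Lemma finite_pressure_cvg B z0 :
  (forall z, (forall k, 0 <= z k <= 1) ->
    mean_field_functional B z <= mean_field_functional B z0) ->
  finite_pressure n B @[n --> \oo] --> mean_field_functional B z0.
Proof.
move=> zV; apply/cvgrPdist_le => e e0; near=> n.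
have h1 : mean_field_functional B z0 - e <= finite_pressure n B.
  by near: n; exact: finite_pressure_ge.
have h2 : finite_pressure n B <= mean_field_functional B z0 + e.
  by near: n; exact: finite_pressure_le.
by rewrite ler_norml; apply/andP; split; lra.
Unshelve. all: by end_near. Qed.

End Pressure.

(** * Maximizers of the mean-field functional *)

(** A nonnegative variable with mean 0 vanishes almost surely; then so would [W], against its
    positive mean. Inequalities strict only where [W > 0] thus become strict in the mean. *)
Lemma mean_gt0 (R : realType) (d : measure_display) (T : measurableType d)
    (P : probability T R) (X W : T -> R) :
  has_mean P X -> has_mean P W -> 0 < mean P W ->
  {ae P, forall x, 0 <= X x} -> {ae P, forall x, X x = 0 -> W x = 0} ->
  0 < mean P X.
Proof.
move=> sX sW W0 X0 XW.
have X_ge0 : 0 <= mean P X by exact: ae_mean_ge0.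
rewrite lt_neqAle X_ge0 andbT; apply/eqP => mX0.
have mX := has_mean_measurable sX.
have mX' : measurable_fun setT (EFin \o X) by exact/measurable_EFinP.
have : (\int[P]_x `|(EFin \o X) x| = 0)%E.
  have -> : (\int[P]_x `|(EFin \o X) x| = \int[P]_x (X x)%:E)%E.
    apply: ae_eq_integral => //; first exact: measurableT_comp.
    by apply: filterS X0 => x h _ /=; rewrite ger0_norm.
  move: mX0; rewrite /mean unlock => mX0.
  rewrite -[LHS]fineK; first by rewrite -mX0.
  by apply: (integrable_fin_num measurableT sX).
move=> /(ae_eq_integral_abs P measurableT mX') aeX.
have aeW : {ae P, forall x, W x = 0}.
  by apply: filterS2 aeX XW => x h1 h2; apply: h2; case: (h1 Logic.I).
have : mean P W <= mean P (fun=> 0).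
  apply: ae_mean_le => //; first exact: has_mean_cst.
  by apply: filterS aeW => x ->.
by rewrite mean_cst leNgt W0.
Qed.

Section Maximizer.
Context {R : realType} {q : nat} (hq : (2 < q)%N).
Let k1 : 'I_q := spin1 hq.
Context {dW : measure_display} {TW : measurableType dW}.
Variables (PW : probability TW R) (W : {RV PW >-> R}).
Hypothesis W2 : ('E_PW[(fun omega => W omega ^+ 2)%R] < +oo)%E.
Hypothesis W_ge0 : {ae PW, forall x, 0 <= W x}.
Hypothesis W_gt0 : 0 < mean PW W.
Variables beta B : R.
Hypotheses (beta_gt0 : 0 < beta) (B_gt0 : 0 < B).

Let b := beta' beta.
Let m := mean PW W.
Let Phi := mean_field_functional k1 W beta B.

Let b_gt0 : 0 < b. Proof. exact: beta'_gt0. Qed.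

Lemma mean_field_log_lipschitz_field (z z' : 'I_q -> R) x e :
  (forall k, `|z k - z' k| <= e) ->
  `|mean_field_log k1 b B z x - mean_field_log k1 b B z' x| <= b * e * `|x|.
Proof.
move=> ze; apply: (lse_lipschitz k1) => k; rewrite /mean_field.
have -> : field1 k1 B k + b * x * z k - (field1 k1 B k + b * x * z' k) =
  b * (z k - z' k) * x by ring.
by rewrite !normrM (ger0_norm (ltW b_gt0)) ler_wpM2r// ler_wpM2l// ltW.
Qed.

Lemma has_mean_field_log z : has_mean PW (mean_field_log k1 b B z \o W).
Proof. exact: (has_mean_lipschitz W2 (mean_field_log_lipschitz k1 beta_gt0 B z)). Qed.

Lemma mean_field_functional_continuous :
  continuous (fun v : 'rV[R]_q => Phi (fun k => v 0 k)).
Proof.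
suff cvg_at (v : 'rV[R]_q) : Phi (fun k => v' 0 k) @[v' --> v] --> Phi (fun k => v 0 k).
  by move=> v; exact: cvg_at.
have cq : \sum_k (v' : 'rV[R]_q) 0 k ^+ 2 @[v' --> v] --> \sum_k v 0 k ^+ 2.
  apply: (@cvg_big _ _ _ _ _ _ _ (nbhs v)) => [|k _]; first exact: add_continuous.
  by apply: (@cvgM _ _ (nbhs v)); exact: coord_continuous.
suff : mean PW (mean_field_log k1 b B (fun k => (v' : 'rV[R]_q) 0 k) \o W) @[v' --> v]
    --> mean PW (mean_field_log k1 b B (fun k => v 0 k) \o W).
  by move=> cl; apply: (cvgB cl (cvgM (cvg_cst _) cq)).
apply/(@cvgrPdist_le _ _ _ (nbhs v)) => e e0.
pose a := mean PW (fun x => `|W x|).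
have sW : has_mean PW (fun x => `|W x|) by exact/has_mean_norm/has_mean_weight.
have a0 : 0 <= a by apply: ae_mean_ge0 => //; exact: aeW.
have d0 : 0 < e / (b * a + 1) by rewrite divr_gt0// ltr_wpDl// mulr_ge0// ltW.
have : \forall v' \near nbhs v, forall k, `|v 0 k - (v' : 'rV[R]_q) 0 k| <= e / (b * a + 1).
  have H k : \forall v' \near nbhs v, `|v 0 k - (v' : 'rV[R]_q) 0 k| <= e / (b * a + 1).
    by have /cvgrPdist_le := @coord_continuous R 1 q 0 k v; exact.
  exact: filter_forall H.
apply: filterS => v' hv'.
rewrite -meanB; [|exact: has_mean_field_log..].
apply: (@le_trans _ _ (b * (e / (b * a + 1)) * a)); last first.
  rewrite mulrAC mulrA ler_pdivrMr ?ltr_wpDl ?mulr_ge0 ?(ltW b_gt0)//.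
  by rewrite mulrC ler_wpM2l ?(ltW e0)// lerDl.
rewrite -meanZ//; apply: ler_norm_mean.
- by apply: has_meanB; exact: has_mean_field_log.
- exact: has_meanZ.
- by move=> x; exact: mean_field_log_lipschitz_field.
Qed.

Lemma mean_field_box_max : exists z0, forall z, (forall k, 0 <= z k <= 1) ->
  Phi z <= Phi z0.
Proof.
pose A := [set v : 'rV[R]_q | forall k, `[0, 1]%classic (v 0 k)].
have cA : compact A := rV_compact (fun=> @segment_compact R 0 1).
have A0 : A !=set0.
  by exists 0 => k /=; rewrite mxE in_itv/= lexx ler01.
have [v _ hv] := EVT_max_rV A0 cA
  (continuous_subspaceT mean_field_functional_continuous).
exists (fun k => v 0 k) => z z01.
have := hv (\row_k z k); rewrite (_ : (fun k => (\row_k z k) 0 k) = z); last first.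
  by apply/funext => k; rewrite mxE.
by apply; apply: mem_set => k /=; rewrite mxE in_itv/=; exact: z01.
Qed.

(** Up to the factor [b], the partial derivative in [z k] of the averaged [lse]; divided by [m] it
    is the mean-field map. *)
Definition tilted_weight (z : 'I_q -> R) (k : 'I_q) : R :=
  mean PW (fun x => W x * gibbs (mean_field k1 b B z (W x)) k).

Lemma measurable_gibbs z k :
  measurable_fun setT (fun x : R => gibbs (mean_field k1 b B z x) k).
Proof.
apply: measurableT_comp => //; apply: measurable_funB; last first.
  exact: (lipschitz_measurable (mean_field_log_lipschitz k1 beta_gt0 B z)).
by apply: measurable_funD => //; apply: measurable_funM.
Qed.

Lemma has_mean_tilted z k :
  has_mean PW (fun x => W x * gibbs (mean_field k1 b B z (W x)) k).
Proof.
apply: (has_mean_linear W2 (f := fun x => x * gibbs (mean_field k1 b B z x) k)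
  (C := 1)) => //.
  by apply: measurable_funM => //; exact: measurable_gibbs.
move=> x; rewrite normrM mul1r -[leRHS]mulr1 ler_pM// ?lerDr// normr_gibbs_le1//.
Qed.

(* One step of the mean-field iteration increases the functional by at least
   [b m / 2] times the squared step length. *)
Lemma mean_field_functional_step z (z' := fun k => tilted_weight z k / m) :
  Phi z + b * m / 2 * \sum_k (z' k - z k) ^+ 2 <= Phi z'.
Proof.
have step : mean PW (mean_field_log k1 b B z \o W) +
    \sum_k b * (z' k - z k) * tilted_weight z k <=
    mean PW (mean_field_log k1 b B z' \o W).
  rewrite (_ : \sum_k _ = mean PW (fun x => \sum_k b * (z' k - z k) *
      (W x * gibbs (mean_field k1 b B z (W x)) k))); last first.
    rewrite mean_sum => [|k]; last by apply: has_meanZ; exact: has_mean_tilted.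
    by apply: eq_bigr => k _; rewrite meanZ//; exact: has_mean_tilted.
  have sS : has_mean PW (fun x => \sum_k b * (z' k - z k) *
      (W x * gibbs (mean_field k1 b B z (W x)) k)).
    by apply: has_mean_sum => k; apply: has_meanZ; exact: has_mean_tilted.
  rewrite -meanD//; last exact: has_mean_field_log.
  apply: mean_le; [apply: has_meanD => //|..]; try exact: has_mean_field_log.
  move=> x /=; have := lse_tangent k1 (mean_field k1 b B z (W x))
    (mean_field k1 b B z' (W x)).
  apply: le_trans; rewrite lerD2l le_eqVlt; apply/orP; left; apply/eqP.
  by apply: eq_bigr => k _; rewrite /mean_field; ring.
have m0 := W_gt0; rewrite -/m in m0.
have tE k : tilted_weight z k = m * z' k by rewrite /z' mulrC divfK// gt_eqF.
have sumE : \sum_k b * (z' k - z k) * tilted_weight z k =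
   b * m / 2 * (\sum_k (z' k - z k) ^+ 2) + b * m / 2 * (\sum_k z' k ^+ 2)
   - b * m / 2 * (\sum_k z k ^+ 2).
  rewrite !mulr_sumr -big_split/= -sumrB; apply: eq_bigr => k _.
  by rewrite tE; field.
rewrite sumE in step.
by rewrite /Phi /mean_field_functional -/m -/b; lra.
Qed.

(** A point moved by the mean-field map would be strictly improved by the step. *)
Lemma maximizer_stationary z : (forall z', Phi z' <= Phi z) ->
  forall k, z k = tilted_weight z k / m.
Proof.
move=> zmax k.
have := le_trans (mean_field_functional_step z) (zmax _).
rewrite gerDl pmulr_rle0; last by rewrite divr_gt0// mulr_gt0.
move=> sum_le0; have /eqP : \sum_k (tilted_weight z k / m - z k) ^+ 2 = 0.
  by apply/eqP; rewrite eq_le sum_le0 sumr_ge0// => j _; exact: sqr_ge0.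
rewrite psumr_eq0 => [|j _]; last exact: sqr_ge0.
by move=> /allP/(_ k (mem_index_enum _)); rewrite sqrf_eq0 subr_eq0 => /eqP.
Qed.

Lemma sum_tilted_weight z : \sum_k tilted_weight z k = m.
Proof.
rewrite -mean_sum => [|k]; last exact: has_mean_tilted.
by apply: eq_mean => x; rewrite -mulr_sumr (sum_gibbs k1) mulr1.
Qed.

Lemma tilted_weight_ge0 z k : 0 <= tilted_weight z k.
Proof.
apply: ae_mean_ge0; first exact: has_mean_tilted.
by apply: filterS W_ge0 => x x0; rewrite mulr_ge0// gibbs_ge0.
Qed.

(** The mean-field map never lowers the functional and sends every [z] into the unit box, its
    coordinates being nonnegative with sum 1. A maximum over the compact box therefore bounds [Phi]
    everywhere. *)
Lemma mean_field_global_max : exists z0, forall z, Phi z <= Phi z0.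
Proof.
have [z0 z0max] := mean_field_box_max; exists z0 => z.
apply: (le_trans (le_trans _ (mean_field_functional_step z))).
  by rewrite lerDl !mulr_ge0 ?divr_ge0 ?(ltW b_gt0) ?(ltW W_gt0)// sumr_ge0//;
    move=> k _; exact: sqr_ge0.
apply: z0max => k; rewrite divr_ge0 ?tilted_weight_ge0 ?(ltW W_gt0)//=.
rewrite ler_pdivrMr// mul1r -(sum_tilted_weight z) (bigD1 k)//= lerDl.
by apply: sumr_ge0 => j _; exact: tilted_weight_ge0.
Qed.

(** Both outer values are compared with the tangent at the middle point; the form without division
    also covers coinciding points. *)
Lemma expR_three_points (x y z s : R) : x <= y -> y <= z ->
  (z - x) * expR (s * y) <= (z - y) * expR (s * x) + (y - x) * expR (s * z).
Proof.
move=> xy yz.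
have E t : expR (s * y) * (1 + s * (t - y)) <= expR (s * t).
  have -> : s * t = s * y + s * (t - y) by ring.
  by rewrite expRD ler_wpM2l ?expR_ge0// expR_ge1Dx.
have Ex : (z - y) * (expR (s * y) * (1 + s * (x - y))) <= (z - y) * expR (s * x).
  by rewrite ler_wpM2l ?subr_ge0.
have Ez : (y - x) * (expR (s * y) * (1 + s * (z - y))) <= (y - x) * expR (s * z).
  by rewrite ler_wpM2l ?subr_ge0.
apply: le_trans (lerD Ex Ez).
by rewrite le_eqVlt; apply/orP; left; apply/eqP; ring.
Qed.

Section OneMaximizer.
Variable z : 'I_q -> R.
Hypothesis zmax : forall z', Phi z' <= Phi z.

Let zE := maximizer_stationary zmax.

Let sum_z : \sum_k z k = 1.
Proof.
under eq_bigr do rewrite zE.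
by rewrite -mulr_suml sum_tilted_weight divff// gt_eqF.
Qed.

Let z_ge0 k : 0 <= z k.
Proof. by rewrite zE divr_ge0 ?tilted_weight_ge0// ltW. Qed.

(* Otherwise exchanging the coordinates [k1] and [k] increases the functional,
   because of the positive field on [k1]. *)
Let z_le1 k : z k <= z k1.
Proof.
rewrite leNgt; apply/negP => zk; have := zmax (fun j => z (tperm k1 k j)).
have k1k : k1 != k by apply/eqP => kE; rewrite kE ltxx in zk.
have sq : \sum_j z (tperm k1 k j) ^+ 2 = \sum_j z j ^+ 2.
  by rewrite [RHS](reindex_inj (@perm_inj _ (tperm k1 k))).
rewrite /Phi /mean_field_functional sq lerD2r leNgt => /negP; apply.
rewrite -subr_gt0 -meanB; [|exact: has_mean_field_log..].
have logE x : mean_field_log k1 b B (fun j => z (tperm k1 k j)) x -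
    mean_field_log k1 b B z x =
  ln (\sum_j expR (mean_field k1 b B z x j) + (expR B - 1) *
    (expR (b * x * z k) - expR (b * x * z k1))) -
  ln (\sum_j expR (mean_field k1 b B z x j)).
  congr (ln _ - _); rewrite (bigD1 k1)//= (bigD1 k)/= 1?eq_sym//.
  rewrite [in RHS](bigD1 k1)//= [in RHS](bigD1 k)/= 1?eq_sym//.
  rewrite /mean_field /field1 eqxx (negbTE (_ : k != k1)) 1?eq_sym//.
  rewrite tpermL tpermR !expRD expR0 -!addrA.
  have -> : \sum_(i < q | (i != k1) && (i != k))
      expR ((if i == k1 then B else 0) + b * x * z (tperm k1 k i)) =
    \sum_(i < q | (i != k1) && (i != k))
      expR ((if i == k1 then B else 0) + b * x * z i).
    by apply: eq_bigr => i /andP[i1 i2]; rewrite tpermD// eq_sym.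
  by ring.
have pos x : 0 < x -> \sum_j expR (mean_field k1 b B z x j) <
    \sum_j expR (mean_field k1 b B z x j) + (expR B - 1) *
    (expR (b * x * z k) - expR (b * x * z k1)).
  move=> x0; rewrite ltrDl mulr_gt0 ?subr_gt0 ?expR_gt1// ltr_expR.
  by rewrite ltr_pM2l// mulr_gt0.
have s0 x : 0 < \sum_j expR (mean_field k1 b B z x j) by exact: (sum_expR_gt0 k1).
have logpos x : 0 < x -> 0 < mean_field_log k1 b B (fun j => z (tperm k1 k j)) x -
    mean_field_log k1 b B z x.
  move=> x0; rewrite logE subr_gt0 ltr_ln ?posrE//; first exact: pos.
  exact: lt_trans (s0 x) (pos x x0).
apply: (mean_gt0 (W := W)) => //; first by apply: has_meanB; exact: has_mean_field_log.
- exact: has_mean_weight.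
- apply: filterS W_ge0 => x; rewrite le_eqVlt => /predU1P[x0|/logpos/ltW//].
  by rewrite /= logE -x0 !mulr0 !mul0r !subrr mulr0 addr0 subrr.
- apply: filterS W_ge0 => x; rewrite le_eqVlt => /predU1P[->//|/logpos h] /= h0.
  by rewrite h0 ltxx in h.
Qed.

Let z1_gt0 : 0 < z k1.
Proof.
rewrite ltNge; apply/negP => z1.
have : \sum_k z k <= 0 by apply: sumr_le0 => k _; exact: le_trans (z_le1 k) z1.
by rewrite sum_z ler10.
Qed.

(* With [D] the partition function, [h y = M(x e^(b x y) / D) / m] is convex, equals
   [y] at [z k] for [k != k1], and equals [e^(-B) z k1 < z k1] at [z k1]. *)
Let z_eq k j : k != k1 -> j != k1 -> z k <= z j -> z k = z j.
Proof.
move=> kk jk zkj; apply/eqP; rewrite eq_le zkj leNgt/=; apply/negP => lt_kj.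
have : (z k1 - z k) * tilted_weight z j <= (z k1 - z j) * tilted_weight z k +
    (z j - z k) * expR (- B) * tilted_weight z k1.
  rewrite -!meanZ; [|exact: has_mean_tilted..].
  rewrite -meanD; [|apply: has_meanZ; exact: has_mean_tilted..].
  apply: ae_mean_le.
  - by apply: has_meanZ; exact: has_mean_tilted.
  - by apply: has_meanD; apply: has_meanZ; exact: has_mean_tilted.
  apply: filterS W_ge0 => x x0.
  have := expR_three_points (b * W x) zkj (z_le1 j).
  set D := \sum_i expR (mean_field k1 b B z (W x) i).
  have D0 : 0 < D by exact: (sum_expR_gt0 k1).
  have gE i : i != k1 -> gibbs (mean_field k1 b B z (W x)) i = expR (b * W x * z i) / D.
    by move=> ik; rewrite gibbsE /mean_field /field1 (negbTE ik) add0r.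
  have g1 : expR (- B) * gibbs (mean_field k1 b B z (W x)) k1 =
      expR (b * W x * z k1) / D.
    by rewrite gibbsE mulrA -expRD /mean_field /field1 eqxx addrA addNr add0r.
  rewrite (gE k kk) (gE j jk) => h.
  rewrite [X in _ <= _ + X](_ : _ = (z j - z k) * (W x * (expR (b * W x * z k1) / D)));
    last by rewrite -g1; ring.
  have xD : 0 <= W x / D by rewrite divr_ge0// ltW.
  have := ler_wpM2l xD h; rewrite mulrDr.
  by congr (_ <= _); ring.
have tE i : tilted_weight z i = m * z i.
  by rewrite [z i]zE mulrC divfK// gt_eqF.
rewrite !tE => h.
have eB : expR (- B) < 1 by rewrite expR_lt1 oppr_lt0.
have h2 : (z j - z k) * (expR (- B) * z k1) < (z j - z k) * (1 * z k1).
  by rewrite ltr_pM2l ?subr_gt0// ltr_pM2r.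
have : (z k1 - z k) * z j <= (z k1 - z j) * z k + (z j - z k) * (expR (- B) * z k1).
  rewrite -(ler_pM2l W_gt0) -/m; move: h; rewrite le_eqVlt.
  by move=> h; rewrite le_eqVlt; move: h; congr (_ || _); [congr eq_op|congr Order.lt]; ring.
by move: h2; rewrite mul1r; lra.
Qed.

(** The line through the uniform vector ([s = 0]) and the unit mass on colour 1 ([s = 1]); [s] is
    the gap between the first coordinate and the common value of the others. *)
Definition profile (s : R) (k : 'I_q) : R :=
  if k == k1 then (1 + (q%:R - 1) * s) / q%:R else (1 - s) / q%:R.

Lemma maximizer_profile : exists2 s, 0 <= s <= 1 & z =1 profile s.
Proof.
pose k2 : 'I_q := Ordinal (ltnW hq).
have k21 : k2 != k1 by [].
have zc k : k != k1 -> z k = z k2.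
  by move=> kk; have [/z_eq->//|/ltW/z_eq->//] := leP (z k) (z k2).
have sumE : z k1 + (q%:R - 1) * z k2 = 1.
  rewrite -[RHS]sum_z (bigD1 k1)//=; congr +%R; apply: esym.
  rewrite (eq_bigr (fun=> z k2)) => [|k kk]; last exact: zc.
  rewrite sumr_const cardC1 card_ord -[LHS]mulr_natl -subn1 natrB//.
  exact: (ltn_trans _ hq).
have q0 : 0 < q%:R :> R by rewrite ltr0n (ltn_trans _ hq).
exists (z k1 - z k2).
  rewrite subr_ge0 z_le1/=.
  have z20 := z_ge0 k2; have q2 : 2 < q%:R :> R by rewrite ltr_nat.
  by have : 0 <= (q%:R - 1) * z k2; [rewrite mulr_ge0//; lra|lra].
move=> k; rewrite /profile; case: eqP => [->|/eqP kk].
  by apply: (mulIf (lt0r_neq0 q0)); rewrite divfK ?gt_eqF//; lra.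
by rewrite (zc k kk); apply: (mulIf (lt0r_neq0 q0)); rewrite divfK ?gt_eqF//; lra.
Qed.

End OneMaximizer.

End Maximizer.

(** * Reduction to one variable *)

Section Profile.
Context {R : realType} {q : nat} (hq : (2 < q)%N).
Let k1 : 'I_q := spin1 hq.
Context {dW : measure_display} {TW : measurableType dW}.
Variables (PW : probability TW R) (W : {RV PW >-> R}).
Hypothesis W2 : ('E_PW[(fun omega => W omega ^+ 2)%R] < +oo)%E.
Hypothesis W_ge0 : {ae PW, forall x, 0 <= W x}.
Hypothesis W_gt0 : 0 < mean PW W.
Variable beta : R.
Hypothesis beta_gt0 : 0 < beta.

Let b := beta' beta.
Let m := mean PW W.

Let b_gt0 : 0 < b. Proof. exact: beta'_gt0. Qed.
Let q_gt0 : 0 < q%:R :> R. Proof. by rewrite ltr0n (ltn_trans _ hq). Qed.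
Let q_gt2 : 2 < q%:R :> R. Proof. by rewrite ltr_nat. Qed.
Let q1_ge0 : 0 <= q%:R - 1 :> R. Proof. by have := q_gt2; lra. Qed.

Lemma sum_neq_spin1 (c : R) : \sum_(k < q | k != k1) c = (q%:R - 1) * c.
Proof.
rewrite sumr_const cardC1 card_ord -[LHS]mulr_natl -subn1 natrB//.
exact: (ltn_trans _ hq).
Qed.

Lemma mean_field_profile B s x k : mean_field k1 b B (profile hq s) x k =
  (if k == k1 then b * x * s + B else 0) + b * x * ((1 - s) / q%:R).
Proof.
rewrite /mean_field /field1 /profile; case: eqP => _; last by rewrite !add0r.
by field; rewrite gt_eqF.
Qed.

Let sum_field u : \sum_k expR (if k == k1 then u else 0) = expR u + (q%:R - 1) :> R.
Proof.
rewrite (bigD1 k1)//= ?eqxx; congr +%R.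
rewrite (eq_bigr (fun=> 1)) => [|k /negbTE ->]; last by rewrite expR0.
by rewrite sum_neq_spin1 mulr1.
Qed.

Lemma mean_field_log_profile B s x : mean_field_log k1 b B (profile hq s) x =
  ln (expR (b * x * s + B) + (q%:R - 1)) + b * x * ((1 - s) / q%:R).
Proof.
rewrite /mean_field_log (eq_lse (mean_field_profile B s x)) (lseD k1).
by rewrite /lse sum_field.
Qed.

Lemma gibbs_profile B s x : gibbs (mean_field k1 b B (profile hq s) x) k1 =
  logistic (q%:R - 1) (b * x * s + B).
Proof.
rewrite /gibbs mean_field_profile eqxx -/(mean_field_log _ _ _ _ _).
rewrite mean_field_log_profile opprD addrACA subrr addr0.
have p0 : 0 < expR (b * x * s + B) + (q%:R - 1) by rewrite ltr_wpDr ?expR_gt0.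
by rewrite expRB lnK.
Qed.

Lemma sum_profile_sq (s : R) :
  \sum_k profile hq s k ^+ 2 = (1 + (q%:R - 1) * s ^+ 2) / q%:R.
Proof.
rewrite (bigD1 k1)//= (eq_bigr (fun=> ((1 - s) / q%:R) ^+ 2)); last first.
  by move=> k /negbTE kk; rewrite /profile kk.
by rewrite sum_neq_spin1 /profile ?eqxx; field; rewrite gt_eqF.
Qed.

Lemma p_funE B s : p_fun W q beta B s =
  mean_field_functional k1 W beta B (profile hq s).
Proof.
rewrite /p_fun /mean_field_functional sum_profile_sq -/b -/m.
pose X x : R := ln (expR (b * W x * s + B) + (q%:R - 1)).
have XE x : mean_field_log k1 b B (profile hq s) (W x) =
    X x + b * ((1 - s) / q%:R) * W x.
  by rewrite mean_field_log_profile; congr +%R; ring.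
have sX : has_mean PW X.
  apply: (@eq_has_mean _ _ _ _ (fun x => mean_field_log k1 b B (profile hq s) (W x) -
     b * ((1 - s) / q%:R) * W x)) => [x|]; first by rewrite XE addrK.
  apply: has_meanB; first exact: has_mean_field_log.
  by apply: has_meanZ; exact: has_mean_weight.
have -> : mean PW (mean_field_log k1 b B (profile hq s) \o W) =
    mean PW X + b * ((1 - s) / q%:R) * m.
  rewrite (eq_mean _ XE) meanD//; last by apply: has_meanZ; exact: has_mean_weight.
  by rewrite meanZ//; exact: has_mean_weight.
have -> : mean PW (fun x => ln (expR (b * W x * s + B) + q%:R - 1)) = mean PW X.
  by apply: eq_mean => x; rewrite /X addrA.
by field; rewrite gt_eqF.
Qed.

Lemma potts_functionalE B (y : 'rV[R]_q) : potts_functional W k1 beta B y =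
  mean_field_functional k1 W beta B (fun k => y 0 k / m).
Proof.
have m0 : 0 < m by [].
rewrite /potts_functional /mean_field_functional -/b -/m; congr (_ - _); last first.
  rewrite [in RHS](eq_bigr (fun k => (m ^- 2) * y 0 k ^+ 2)) => [|k _].
    by rewrite -mulr_sumr; field; rewrite gt_eqF.
  by field; rewrite gt_eqF.
apply: eq_mean => x /=; rewrite /mean_field_log /lse [in RHS](bigD1 k1)//=.
congr (ln (expR _ + _)); first by rewrite /mean_field /field1 eqxx /scaled_exp -/b -/m; ring.
apply: eq_bigr => k /negbTE kk; congr expR.
by rewrite /mean_field /field1 kk /scaled_exp -/b -/m; ring.
Qed.

(** The first tilted weight of a profile, with [t = b s]; it is the slope of the averaged softplus
    and, up to an affine change, [scrF]. *)
Definition tilt B t : R := mean PW (fun x => W x * logistic (q%:R - 1) (t * W x + B)).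

Lemma logistic_measurable B t :
  measurable_fun setT (fun x : R => logistic (q%:R - 1) (t * x + B)).
Proof.
apply: (@lipschitz_measurable _ _ `|t|) => x y.
apply: le_trans (logistic_lipschitz _ _ q1_ge0) _.
by rewrite -normrM le_eqVlt; apply/orP; left; apply/eqP; congr `|_|; ring.
Qed.

Lemma has_mean_logistic B t :
  has_mean PW (fun x => logistic (q%:R - 1) (t * W x + B)).
Proof.
apply: (has_mean_linear W2 (C := 1) _ (logistic_measurable B t)) => // x.
by rewrite ger0_norm ?logistic_ge0// (le_trans (logistic_le1 _ q1_ge0))// mul1r lerDl.
Qed.

Lemma has_mean_tilt B t :
  has_mean PW (fun x => W x * logistic (q%:R - 1) (t * W x + B)).
Proof.
apply: (has_mean_linear W2 (f := fun x => x * logistic (q%:R - 1) (t * x + B)) (C := 1)) => //.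
  by apply: measurable_funM => //; exact: logistic_measurable.
move=> x; rewrite normrM mul1r -[leRHS]mulr1 ler_pM// ?lerDr//.
by rewrite ger0_norm ?logistic_ge0// logistic_le1.
Qed.

Lemma scrFE B t : scrF W q B t = (q%:R * tilt B t / m - 1) / (q%:R - 1).
Proof.
have q1 : 0 < q%:R - 1 :> R by have := q_gt2; lra.
have m0 : 0 < m by [].
rewrite /scrF -/m.
rewrite (eq_mean _ (Y := fun x => q%:R / m / (q%:R - 1) *
   (W x * logistic (q%:R - 1) (t * W x + B)) - (m * (q%:R - 1))^-1 * W x)); last first.
  move=> x; rewrite /logistic; have := expR_gt0 (t * W x + B) => e0.
  field; rewrite !gt_eqF//=; lra.
rewrite meanB; [|by apply: has_meanZ; exact: has_mean_tilt
                |by apply: has_meanZ; exact: has_mean_weight].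
rewrite !meanZ; [|exact: has_mean_weight|exact: has_mean_tilt].
by rewrite -/m -/(tilt B t); field; rewrite !gt_eqF.
Qed.

Section PositiveField.
Variable B : R.
Hypothesis B_gt0 : 0 < B.

Let Phi := mean_field_functional k1 W beta B.

Lemma maximizer_is_profile z : (forall z', Phi z' <= Phi z) ->
  exists s, [/\ p_maximizers W q beta B s, z = profile hq s & Phi z = p_fun W q beta B s].
Proof.
move=> zmax; have [s s01 /funext zs] := maximizer_profile W2 W_ge0 W_gt0 beta_gt0 B_gt0 zmax.
exists s; split => //; last by rewrite p_funE -zs.
by split=> // u _; rewrite !p_funE -zs.
Qed.

Lemma p_maximizers_nonempty : exists s, p_maximizers W q beta B s.
Proof.
have [z zmax] := mean_field_global_max hq W2 W_ge0 W_gt0 B beta_gt0.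
by have [s [sp _ _]] := maximizer_is_profile zmax; exists s.
Qed.

(** The maximum over all [z] is attained at a profile with parameter in [[0, 1]], so the
    one-variable maximum equals it. *)
Lemma p_maximizer_global s : p_maximizers W q beta B s ->
  forall z, Phi z <= p_fun W q beta B s.
Proof.
move=> [s01 smax] z0.
have [z zmax] := mean_field_global_max hq W2 W_ge0 W_gt0 B beta_gt0.
have [u [[u01 _] _ zu]] := maximizer_is_profile zmax.
by apply: (le_trans (zmax z0)); have := smax u u01; rewrite -zu.
Qed.

(** Stationarity is read off in the [q]-dimensional problem, where the profile is an unconstrained
    maximizer. This gives equality even for [s] at an end of [[0, 1]], where a derivative test on
    the interval would only give an inequality. *)
Lemma p_maximizer_scrF s : p_maximizers W q beta B s -> scrF W q B (b * s) = s.
Proof.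
move=> sp.
have zmax z' : Phi z' <= Phi (profile hq s).
  by rewrite -[leRHS]p_funE; exact: p_maximizer_global.
have := maximizer_stationary W2 W_gt0 beta_gt0 zmax k1.
rewrite /tilted_weight (eq_mean _ (Y := fun x => W x *
    logistic (q%:R - 1) (b * s * W x + B))); last first.
  by move=> x; rewrite gibbs_profile mulrAC.
rewrite -/(tilt B (b * s)) /profile eqxx -/m => h.
have q1 : 0 < q%:R - 1 :> R by have := q_gt2; lra.
rewrite scrFE -mulrA -h.
by field; rewrite !gt_eqF.
Qed.

End PositiveField.

End Profile.
Arguments tilt {R} q {dW TW PW} W B t.

(** * Uniqueness of the critical value *)

Section CriticalBeta.
Context {R : realType} {q : nat} (hq : (2 < q)%N).
Context {dW : measure_display} {TW : measurableType dW}.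
Variables (PW : probability TW R) (W : {RV PW >-> R}).
Hypothesis W2 : ('E_PW[(fun omega => W omega ^+ 2)%R] < +oo)%E.
Hypothesis W_ge0 : {ae PW, forall x, 0 <= W x}.
Hypothesis W_gt0 : 0 < mean PW W.
Variable B : R.
Hypothesis B_gt0 : 0 < B.

Let m := mean PW W.
Let c : R := q%:R - 1.
Let q_gt2 : 2 < q%:R :> R. Proof. by rewrite ltr_nat. Qed.
Let c_gt0 : 0 < c. Proof. by rewrite /c; have := q_gt2; lra. Qed.
Let c_ge0 : 0 <= c. Proof. exact: ltW. Qed.
Let m_gt0 : 0 < m. Proof. by []. Qed.

Definition mean_softplus (t : R) : R :=
  mean PW (fun x => ln (expR (t * W x + B) + (q%:R - 1))).

Lemma has_mean_softplus t :
  has_mean PW (fun x => ln (expR (t * W x + B) + (q%:R - 1))).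
Proof.
apply: (has_mean_lipschitz W2 (g := fun x => ln (expR (t * x + B) + c)) (L := `|t|)) => x y.
apply: le_trans (softplus_lipschitz _ _ c_ge0) _.
by rewrite -normrM le_eqVlt; apply/orP; left; apply/eqP; congr `|_|; ring.
Qed.

Lemma mean_softplus_tangent t u :
  mean_softplus t + tilt q W B t * (u - t) <= mean_softplus u.
Proof.
rewrite mulrC -meanZ; last exact: has_mean_tilt.
rewrite -meanD; [|exact: has_mean_softplus|apply: has_meanZ; exact: has_mean_tilt].
apply: mean_le.
- by apply: has_meanD; [exact: has_mean_softplus|apply: has_meanZ; exact: has_mean_tilt].
- exact: has_mean_softplus.
- move=> x; apply: le_trans (softplus_tangent (t * W x + B) (u * W x + B) c_ge0).
  by rewrite lerD2l le_eqVlt; apply/orP; left; apply/eqP; rewrite /c; ring.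
Qed.

(** One factor [W] is the tilt, the other comes from the argument of [logistic]: hence the second
    moment. *)
Lemma tilt_lipschitz t u :
  `|tilt q W B t - tilt q W B u| <= mean PW (fun x => W x ^+ 2) * `|t - u|.
Proof.
rewrite -meanB; [|exact: has_mean_tilt..].
rewrite mulrC -meanZ; last exact: has_mean_sq.
apply: ler_norm_mean.
- by apply: has_meanB; exact: has_mean_tilt.
- by apply: has_meanZ; exact: has_mean_sq.
move=> x; rewrite -mulrBr normrM -(real_normK (num_real (W x))) expr2 mulrCA.
rewrite ler_wpM2l//; apply: le_trans (logistic_lipschitz _ _ c_ge0) _.
rewrite -normrM le_eqVlt; apply/orP; left; apply/eqP.
by rewrite mulrC; congr `|_|; ring.
Qed.

Lemma tilt_continuous : continuous (tilt q W B).
Proof. exact: lipschitz_continuous tilt_lipschitz. Qed.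

Lemma is_derive_mean_softplus (t : R) : is_derive t 1 mean_softplus (tilt q W B t).
Proof.
apply: is_derive_tangent; first exact: tilt_continuous.
exact: mean_softplus_tangent.
Qed.

Lemma scrF_continuous : continuous (scrF W q B).
Proof.
have -> : scrF W q B = fun t => (q%:R * tilt q W B t / m - 1) / c.
  by apply/funext => t; rewrite scrFE.
move=> t; apply: cvgM; last exact: cvg_cst.
apply: cvgB; last exact: cvg_cst.
apply: cvgM; last exact: cvg_cst.
by apply: cvgM; [exact: cvg_cst|exact: tilt_continuous].
Qed.

Lemma scrF_nondecreasing : {homo scrF W q B : t u / t <= u}.
Proof.
move=> t u tu; rewrite !scrFE// ler_wpM2r ?invr_ge0// lerD2r.
rewrite ler_wpM2r ?invr_ge0 ?(ltW m_gt0)// ler_wpM2l//.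
apply: ae_mean_le; [exact: has_mean_tilt..|].
apply: filterS W_ge0 => x x0; rewrite ler_wpM2l// logistic_incr// lerD2r.
by rewrite ler_wpM2r.
Qed.

(** With [t = b s] the expectation no longer depends on [b], which survives only in the quadratic
    coefficient and in a constant. Problems at different [beta] become comparable. *)
Definition rescaled_p (b t : R) : R :=
  mean_softplus t - m * (q%:R - 1) / (2 * q%:R * b) * t ^+ 2
  - m / q%:R * t + m * b / (2 * q%:R).

Lemma p_fun_rescaled beta s : 0 < beta ->
  p_fun W q beta B s = rescaled_p (beta' beta) (beta' beta * s).
Proof.
move=> beta0; have b0 : 0 < beta' beta by exact: beta'_gt0.
rewrite /p_fun /rescaled_p -/m.
have -> : mean_softplus (beta' beta * s) =
    mean PW (fun x => ln (expR (beta' beta * W x * s + B) + q%:R - 1)).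
  by apply: eq_mean => x; rewrite addrA mulrAC.
have q0 : 0 < q%:R :> R by have := q_gt2; lra.
by field; rewrite !gt_eqF//; lra.
Qed.

Lemma is_derive_rescaled_p (b t : R) : 0 < b ->
  is_derive t 1 (rescaled_p b) (m * (q%:R - 1) / q%:R * (scrF W q B t - t / b)).
Proof.
move=> b0; have q0 : 0 < q%:R :> R by have := q_gt2; lra.
have h := is_derive_mean_softplus t.
pose k := m * (q%:R - 1) / (2 * q%:R * b).
have -> : rescaled_p b = mean_softplus \- (k *: (id ^+ 2))%R
    \- ((m / q%:R) *: id)%R \+ cst (m * b / (2 * q%:R)).
  by apply/funext => x; rewrite /rescaled_p.
apply: is_derive_eq.
rewrite scrFE// -/m /k /GRing.scale/=.
by field; rewrite !gt_eqF//; lra.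
Qed.

(** Valid at every [t]: without a derivative, [derive1] is 0. *)
Lemma scrF_derive1_ge0 (t : R) : 0 <= derive1 (scrF W q B) t.
Proof.
have [->//|/derive1_neq0_derivable dF] := eqVneq (derive1 (scrF W q B) t) 0.
exact: nondecreasing_derive1_ge0 scrF_nondecreasing dF.
Qed.

(** * Consequences of the single inflection point *)

Section ZeroCrossing.
Variable t0 : R.
Hypothesis convex_part : forall t, 0 < t < t0 -> 0 < derive1n 2 (scrF W q B) t.
Hypothesis concave_part : forall t, t0 < t -> derive1n 2 (scrF W q B) t < 0.

Let dF := derive1 (scrF W q B).

Let dF_derivable t : derive1n 2 (scrF W q B) t != 0 -> derivable dF t 1.
Proof. by rewrite derive1nS derive1n1 => /derive1_neq0_derivable. Qed.

Lemma slope_incr x y : 0 < x -> x < y -> y < t0 -> dF x < dF y.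
Proof.
move=> x0 xy yt.
have mid t : x <= t -> t <= y -> 0 < t < t0.
  by move=> xt ty; rewrite (lt_le_trans x0 xt) (le_lt_trans ty yt).
apply: (@gtr0_derive1_incr _ dF x y) => //.
- move=> t; rewrite in_itv/= => /andP[/ltW xt /ltW ty].
  by apply: dF_derivable; rewrite gt_eqF// convex_part// mid.
- move=> t; rewrite in_itv/= => /andP[/ltW xt /ltW ty].
  by have := convex_part (mid t xt ty); rewrite derive1nS derive1n1.
- apply: derivable_within_continuous => t; rewrite in_itv/= => /andP[xt ty].
  by apply: dF_derivable; rewrite gt_eqF// convex_part// mid.
Qed.

Lemma slope_decr x y : t0 < x -> x < y -> dF y < dF x.
Proof.
move=> xt0 xy.
have mid t : x <= t -> t0 < t by move=> xt; exact: lt_le_trans xt0 xt.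
apply: (@ltr0_derive1_decr _ dF x y) => //.
- move=> t; rewrite in_itv/= => /andP[/ltW xt /ltW ty].
  by apply: dF_derivable; rewrite lt_eqF// concave_part// mid.
- move=> t; rewrite in_itv/= => /andP[/ltW xt /ltW ty].
  by have := concave_part (mid t xt); rewrite derive1nS derive1n1.
- apply: derivable_within_continuous => t; rewrite in_itv/= => /andP[xt ty].
  by apply: dF_derivable; rewrite lt_eqF// concave_part// mid.
Qed.

(* The slope is nonnegative everywhere and strictly monotone on either side of
   [t0], hence positive there. *)
Lemma scrF_derivable t : 0 < t -> t != t0 -> derivable (scrF W q B) t 1.
Proof.
move=> tp; rewrite neq_lt => /orP[tt|tt]; apply: derive1_neq0_derivable;
  rewrite gt_eqF//.
  apply: le_lt_trans (scrF_derive1_ge0 (t / 2)) (slope_incr _ _ tt); first lra.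
  by lra.
by apply: le_lt_trans (scrF_derive1_ge0 (t + 1)) (slope_decr tt _); lra.
Qed.

(** Mean value theorem on a chord of the line [t / b]. Derivability is asked inside the interval
    only, so that [0] and [t0] are admissible endpoints. *)
Let chord_slope b x y : 0 < b -> x < y ->
  (forall t, x < t -> t < y -> 0 < t /\ t != t0) ->
  scrF W q B x = x / b -> scrF W q B y = y / b ->
  exists t, [/\ x < t, t < y & dF t = b^-1].
Proof.
move=> b0 xy dom Fx Fy.
have [||t] := @MVT _ (scrF W q B) dF x y xy.
- move=> t; rewrite in_itv/= => /andP[xt ty]; have [tp tt] := dom t xt ty.
  by rewrite /dF derive1E; apply: DeriveDef => //; exact: scrF_derivable.
- exact/continuous_subspaceT/scrF_continuous.
rewrite in_itv/= => /andP[xt ty] e; exists t; split=> //.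
rewrite Fx Fy -mulrBl mulrC in e.
by apply: (@mulIf _ (y - x)); rewrite ?subr_eq0 ?gt_eqF.
Qed.

(** Were all three points on one side of [t0], the two chords would give two points of equal slope
    [1 / b] where the slope is strictly monotone. *)
Lemma three_fixed_points b x y z : 0 < b -> 0 <= x -> x < y -> y < z ->
  scrF W q B x = x / b -> scrF W q B y = y / b -> scrF W q B z = z / b ->
  x < t0 /\ t0 < z.
Proof.
move=> b0 x0 xy yz Fx Fy Fz; split; rewrite ltNge; apply/negP => h.
  have [|t [xt ty dt]] := chord_slope b0 xy _ Fx Fy.
    move=> t xt _; split; first exact: le_lt_trans x0 xt.
    by rewrite gt_eqF// (le_lt_trans h).
  have [|u [yu uz du]] := chord_slope b0 yz _ Fy Fz.
    move=> u yu _; have xu := lt_trans xy yu; split; first exact: le_lt_trans x0 xu.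
    by rewrite gt_eqF// (le_lt_trans h).
  have := slope_decr (le_lt_trans h xt) (lt_trans ty yu).
  by rewrite dt du ltxx.
have [|t [xt ty dt]] := chord_slope b0 xy _ Fx Fy.
  move=> t xt ty; split; first exact: le_lt_trans x0 xt.
  by rewrite lt_eqF// (lt_le_trans (lt_trans ty yz)).
have [|u [yu uz du]] := chord_slope b0 yz _ Fy Fz.
  move=> u yu uz; split; first exact: le_lt_trans x0 (lt_trans xy yu).
  by rewrite lt_eqF// (lt_le_trans uz).
have := slope_incr (le_lt_trans x0 xt) (lt_trans ty yu) (lt_le_trans uz h).
by rewrite dt du ltxx.
Qed.

Lemma two_maximizers_straddle beta s u : 0 < beta ->
  p_maximizers W q beta B s -> p_maximizers W q beta B u -> s < u ->
  beta' beta * s < t0 /\ t0 < beta' beta * u.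
Proof.
move=> beta0 sp up su; have b0 : 0 < beta' beta := beta'_gt0 beta0.
set b := beta' beta in b0 *.
have Fs := p_maximizer_scrF hq W2 W_ge0 W_gt0 beta0 B_gt0 sp.
have Fu := p_maximizer_scrF hq W2 W_ge0 W_gt0 beta0 B_gt0 up.
have bsu : b * s < b * u by rewrite ltr_pM2l.
have pE : rescaled_p b (b * s) = rescaled_p b (b * u).
  rewrite -!p_fun_rescaled//; apply/eqP; rewrite eq_le.
  by case: sp up => [s01 sm] [u01 um]; rewrite um ?sm.
have [||cc] := Rolle bsu _ _ pE.
- by move=> t _; have [] := is_derive_rescaled_p t b0.
- apply: derivable_within_continuous => t _.
  by have [] := is_derive_rescaled_p t b0.
rewrite in_itv/= => /andP[sc cu] dc.
have q0 : 0 < q%:R :> R by have := q_gt2; lra.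
have Fc : scrF W q B cc = cc / b.
  have dc' := is_derive_rescaled_p cc b0.
  have /eqP := etrans (esym (@derive_val _ _ _ _ _ _ _ dc')) (@derive_val _ _ _ _ _ _ _ dc).
  have nz : m * (q%:R - 1) / q%:R != 0 by rewrite gt_eqF// divr_gt0// mulr_gt0.
  by rewrite mulf_eq0 (negbTE nz)/= subr_eq0 => /eqP.
have bK r : b * r / b = r by rewrite mulrC mulKf// gt_eqF.
apply: (three_fixed_points b0 _ sc cu) => //; rewrite ?bK//.
by have [/andP[s0 _] _] := sp; rewrite mulr_ge0// ltW.
Qed.

(** Each maximizer is tested against the value of [t] of the other. Adding the two inequalities
    cancels everything but the quadratic terms, and [1 / b - 1 / b2 > 0] decides the sign. The rival
    parameter may leave [[0, 1]], so maximality over all [z] is used. *)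
Lemma maximizers_nondecreasing beta beta2 s u : 0 < beta -> beta < beta2 ->
  p_maximizers W q beta B s -> p_maximizers W q beta2 B u ->
  beta' beta * s <= beta' beta2 * u.
Proof.
move=> beta0 bb sp up; have beta20 := lt_trans beta0 bb.
have b0 : 0 < beta' beta := beta'_gt0 beta0.
have b20 : 0 < beta' beta2 := beta'_gt0 beta20.
have b12 : beta' beta < beta' beta2 by rewrite ltrD2r ltr_expR.
have [/andP[s0 _] _] := sp; have [/andP[u0 _] _] := up.
have := p_maximizer_global hq W2 W_ge0 W_gt0 beta0 B_gt0 sp
  (profile hq (beta' beta2 * u / beta' beta)).
have := p_maximizer_global hq W2 W_ge0 W_gt0 beta20 B_gt0 up
  (profile hq (beta' beta * s / beta' beta2)).
rewrite -!p_funE// !p_fun_rescaled//.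
set b := beta' beta in b0 b12 *; set b2 := beta' beta2 in b20 b12 *.
rewrite [b2 * (_ / b2)]mulrC divfK ?gt_eqF// [b * (_ / b)]mulrC divfK ?gt_eqF//.
set t := b * s; set t2 := b2 * u; rewrite /rescaled_p => h1 h2.
have q0 : 0 < q%:R :> R by have := q_gt2; lra.
have k0 : 0 < m * (q%:R - 1) / (2 * q%:R).
  by rewrite divr_gt0// mulr_gt0.
have kE bb' : 0 < bb' -> m * (q%:R - 1) / (2 * q%:R * bb') =
    m * (q%:R - 1) / (2 * q%:R) * bb'^-1.
  by move=> b'0; field; rewrite !gt_eqF.
have key : 0 <= m * (q%:R - 1) / (2 * q%:R) * ((b^-1 - b2^-1) * (t2 ^+ 2 - t ^+ 2)).
  have e1 := kE _ b0; have e2 := kE _ b20.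
  by rewrite e1 e2 in h1 h2; lra.
have bi : 0 < b^-1 - b2^-1 by rewrite subr_gt0 ltf_pV2.
rewrite pmulr_rge0// pmulr_rge0// subr_ge0 in key.
by rewrite -ler_sqr// nnegrE mulr_ge0// ltW.
Qed.

End ZeroCrossing.

Lemma critical_beta_unique beta beta2 : zero_crossing W q B ->
  0 < beta -> 0 < beta2 ->
  (exists s u, [/\ p_maximizers W q beta B s, p_maximizers W q beta B u & s != u]) ->
  (exists s u, [/\ p_maximizers W q beta2 B s, p_maximizers W q beta2 B u & s != u]) ->
  beta = beta2.
Proof.
move=> [t0 [_ conv conc _]] b10 b20 ex1 ex2.
have sorted b : (exists s u, [/\ p_maximizers W q b B s, p_maximizers W q b B u & s != u]) ->
    exists s u, [/\ p_maximizers W q b B s, p_maximizers W q b B u & s < u].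
  by move=> [s [u [sp up]]]; rewrite neq_lt => /orP[su|us]; [exists s, u|exists u, s].
have H b b' : 0 < b -> b < b' ->
    (exists s u, [/\ p_maximizers W q b B s, p_maximizers W q b B u & s < u]) ->
    ~ (exists s u, [/\ p_maximizers W q b' B s, p_maximizers W q b' B u & s < u]).
  move=> b0 bb' [s [u [sp up su]]] [s' [u' [sp' up' su']]].
  have [_ tu] := two_maximizers_straddle conv conc b0 sp up su.
  have [ts' _] := two_maximizers_straddle conv conc (lt_trans b0 bb') sp' up' su'.
  have := lt_trans (lt_le_trans tu (maximizers_nondecreasing b0 bb' up sp')) ts'.
  by rewrite ltxx.
have [lt12|lt21|//] := ltgtP beta beta2.
  by case: (H _ _ b10 lt12 (sorted _ ex1) (sorted _ ex2)).
by case: (H _ _ b20 lt21 (sorted _ ex2) (sorted _ ex1)).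
Qed.

(** Two maximizers at [beta] make the set defining [critical_beta] nonempty, so [get] returns one of
    its elements, which can only be [beta]. *)
Lemma p_maximizer_unique beta s u : zero_crossing W q B -> 0 < beta ->
  beta != critical_beta W q B ->
  p_maximizers W q beta B s -> p_maximizers W q beta B u -> s = u.
Proof.
move=> zc beta0 /eqP bc sp up; apply/eqP/negPn/negP => su; apply: bc.
have ex : exists s u, [/\ p_maximizers W q beta B s, p_maximizers W q beta B u & s != u].
  by exists s, u.
have [c0 exc] := @getPex _ [set beta | 0 < beta /\
    exists s u : R, [/\ p_maximizers W q beta B s, p_maximizers W q beta B u & s != u]]
  (ex_intro _ beta (conj beta0 ex)).
exact: critical_beta_unique zc beta0 c0 ex exc.
Qed.

End CriticalBeta.
Arguments mean_softplus {R} q {dW TW PW} W B t.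
Arguments rescaled_p {R} q {dW TW PW} W B b t.

(** * Differentiating the pressure in the field *)

(** Compactness: on the parts of [[0, 1]] at distance at least [e] from [s] the maximum of [f] is
    attained and, by uniqueness, lies below [f s]; [eta] is the smaller of the two gaps. *)
Lemma unique_argmax_stable (R : realType) (f : R -> R) (s : R) :
  continuous f -> (forall u, 0 <= u <= 1 -> f u <= f s) ->
  (forall u, 0 <= u <= 1 -> f u = f s -> u = s) ->
  forall e, 0 < e -> exists2 eta, 0 < eta &
    forall u, 0 <= u <= 1 -> f s - eta < f u -> `|u - s| < e.
Proof.
move=> cf fmax funiq e e0.
have gap x y : 0 <= x -> y <= 1 -> (forall u, x <= u <= y -> u != s) ->
    (* Empty intervals are allowed, since [s - e] may be negative and [s + e] may exceed 1; any
       positive gap then works. *)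
    exists2 eta, 0 < eta & forall u, x <= u <= y -> f u <= f s - eta.
  move=> x0 y1 nes; have [xy|yx] := leP x y; last first.
    exists 1 => // u /andP[xu uy].
    by have := le_lt_trans (le_trans xu uy) yx; rewrite ltxx.
  have [v] := EVT_max xy (continuous_subspaceT cf).
  rewrite in_itv/= => /andP[xv vy] vmax.
  have v01 : 0 <= v <= 1 by rewrite (le_trans x0 xv) (le_trans vy y1).
  exists (f s - f v).
    rewrite subr_gt0 lt_neqAle fmax// andbT; apply/eqP => /(funiq v v01) vs.
    by move: (nes v); rewrite xv vy vs eqxx => /(_ isT).
  by move=> u uxy; rewrite subKr; apply: vmax; rewrite in_itv.
have [|||eta1 eta1_gt0 h1] := gap 0 (Num.min (s - e) 1).
- by [].
- by rewrite ge_min lexx orbT.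
- by move=> u /andP[_]; rewrite le_min => /andP[us _]; rewrite lt_eqF//; lra.
have [|||eta2 eta2_gt0 h2] := gap (Num.max (s + e) 0) 1.
- by rewrite le_max lexx orbT.
- by [].
- by move=> u /andP[]; rewrite ge_max => /andP[us _] _; rewrite gt_eqF//; lra.
exists (Num.min eta1 eta2); first by rewrite lt_min eta1_gt0.
move=> u /andP[u0 u1] fu.
have m1 : Num.min eta1 eta2 <= eta1 by rewrite ge_min lexx.
have m2 : Num.min eta1 eta2 <= eta2 by rewrite ge_min lexx orbT.
rewrite ltr_norml; apply/andP; split; rewrite ltNge; apply/negP => h.
  have := h1 u; rewrite u0 le_min u1 andbT; have -> /= : u <= s - e by lra.
  by move=> /(_ isT); lra.
have := h2 u; rewrite u1 ge_max u0 !andbT; have -> /= : s + e <= u by lra.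
by move=> /(_ isT); lra.
Qed.

Section FieldDerivative.
Context {R : realType} {q : nat} (hq : (2 < q)%N).
Let k1 : 'I_q := spin1 hq.
Context {dW : measure_display} {TW : measurableType dW}.
Variables (PW : probability TW R) (W : {RV PW >-> R}).
Hypothesis W2 : ('E_PW[(fun omega => W omega ^+ 2)%R] < +oo)%E.
Hypothesis W_ge0 : {ae PW, forall x, 0 <= W x}.
Hypothesis W_gt0 : 0 < mean PW W.
Variable beta : R.
Hypothesis beta_gt0 : 0 < beta.

Let b := beta' beta.
Let m := mean PW W.
Let b_gt0 : 0 < b. Proof. exact: beta'_gt0. Qed.
Let q_gt2 : 2 < q%:R :> R. Proof. by rewrite ltr_nat. Qed.
Let c_ge0 : 0 <= q%:R - 1 :> R. Proof. by have := q_gt2; lra. Qed.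

Definition spin1_mean (B s : R) : R :=
  mean PW (fun x => logistic (q%:R - 1) (b * s * W x + B)).

Let p_split B B' s : p_fun W q beta B s - p_fun W q beta B' s =
  mean_softplus q W B (b * s) - mean_softplus q W B' (b * s).
Proof.
have E C : mean PW (fun x => ln (expR (b * W x * s + C) + q%:R - 1)) =
    mean_softplus q W C (b * s).
  by apply: eq_mean => x; rewrite addrA mulrAC.
by rewrite /p_fun !E; ring.
Qed.

Lemma p_fun_field_tangent B B' s :
  p_fun W q beta B s + (B' - B) * spin1_mean B s <= p_fun W q beta B' s.
Proof.
rewrite -lerBrDl p_split /spin1_mean -meanZ; last exact: has_mean_logistic.
rewrite lerBrDr -meanD; [|apply: has_meanZ; exact: has_mean_logistic|exact: has_mean_softplus].
apply: mean_le.
- by apply: has_meanD; [apply: has_meanZ; exact: has_mean_logistic|exact: has_mean_softplus].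
- exact: has_mean_softplus.
move=> x; apply: le_trans (softplus_tangent (b * s * W x + B) (b * s * W x + B') c_ge0).
by rewrite addrC lerD2l le_eqVlt; apply/orP; left; apply/eqP; ring.
Qed.

Lemma spin1_mean_ge0 B s : 0 <= spin1_mean B s.
Proof.
apply: ae_mean_ge0; first exact: has_mean_logistic.
by apply: aeW => x; exact: logistic_ge0.
Qed.

Lemma spin1_mean_le1 B s : spin1_mean B s <= 1.
Proof.
rewrite -(mean_cst PW 1); apply: mean_le; [exact: has_mean_logistic|exact: has_mean_cst|].
by move=> x; exact: logistic_le1.
Qed.

Lemma p_fun_field_lipschitz B B' s :
  `|p_fun W q beta B s - p_fun W q beta B' s| <= `|B - B'|.
Proof.
wlog BB : B B' / B' <= B.
  by move=> H; have [/H//|/ltW/H] := leP B' B; rewrite distrC [leRHS]distrC.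
have := p_fun_field_tangent B B' s; have := p_fun_field_tangent B' B s.
have h1 : 0 <= (B - B') * spin1_mean B' s by rewrite mulr_ge0 ?subr_ge0 ?spin1_mean_ge0.
have h2 : (B - B') * spin1_mean B s <= B - B'.
  by rewrite ler_piMr ?subr_ge0 ?spin1_mean_le1.
by move=> h3 h4; rewrite !ger0_norm ?subr_ge0//; lra.
Qed.

Lemma spin1_mean_lipschitz B B' s s' :
  `|spin1_mean B s - spin1_mean B' s'| <= b * m * `|s - s'| + `|B - B'|.
Proof.
have sW : has_mean PW (fun x => `|W x|) by exact/has_mean_norm/has_mean_weight.
have aW : mean PW (fun x => `|W x|) = m.
  apply/eqP; rewrite eq_le !ae_mean_le//; try exact: has_mean_weight;
    by apply: filterS W_ge0 => x x0; rewrite ger0_norm.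
rewrite -meanB; [|exact: has_mean_logistic..].
have -> : b * m * `|s - s'| + `|B - B'| =
    mean PW (fun x => b * `|s - s'| * `|W x| + `|B - B'|).
  rewrite meanD ?mean_cst ?meanZ ?aW//; [by ring|exact: has_meanZ|exact: has_mean_cst].
apply: ler_norm_mean.
- by apply: has_meanB; exact: has_mean_logistic.
- by apply: has_meanD; [exact: has_meanZ|exact: has_mean_cst].
move=> x; apply: le_trans (logistic_lipschitz _ _ c_ge0) _.
have -> : b * s * W x + B - (b * s' * W x + B') = b * (s - s') * W x + (B - B') by ring.
by rewrite (le_trans (ler_normD _ _))// lerD2r !normrM (ger0_norm (ltW b_gt0)).
Qed.

Lemma p_fun_continuous B : continuous (p_fun W q beta B).
Proof.
have -> : p_fun W q beta B = rescaled_p q W B b \o (fun s => b * s).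
  by apply/funext => s; rewrite p_fun_rescaled.
move=> s; apply: continuous_comp; first by apply: cvgM; [exact: cvg_cst|exact: cvg_id].
have [dr _] := is_derive_rescaled_p hq W2 W_gt0 B (b * s) b_gt0.
by apply: differentiable_continuous; rewrite -derivable1_diffP.
Qed.

Variables (B s : R).
Hypothesis B_gt0 : 0 < B.
Hypothesis s_max : p_maximizers W q beta B s.
Hypothesis s_uniq : forall u, p_maximizers W q beta B u -> u = s.

(** Uniqueness is assumed at [B] only; at nearby fields some maximizer is chosen. *)
Let field_max (B' : R) : R := get (p_maximizers W q beta B').

Let field_maxP B' : 0 < B' -> p_maximizers W q beta B' (field_max B').
Proof.
move=> B'0; have := p_maximizers_nonempty hq W2 W_ge0 W_gt0 beta_gt0 B'0.
exact: getPex.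
Qed.

(** Changing the field moves [p_fun] by at most [|B - B'|] uniformly in its argument, so a maximizer
    at [B'] is almost maximal at [B], and stability of the unique argmax applies. *)
Lemma field_max_cvg : field_max B' @[B' --> B] --> s.
Proof.
apply/cvgrPdist_lt => e e0.
have [s01 smax] := s_max.
have [eta eta0 stable] : exists2 eta, 0 < eta & forall u, 0 <= u <= 1 ->
    p_fun W q beta B s - eta < p_fun W q beta B u -> `|u - s| < e.
  apply: unique_argmax_stable => //; first exact: p_fun_continuous.
  move=> u u01 us; apply: s_uniq; split=> // v v01; rewrite us; exact: smax.
have eta2 : 0 < eta / 2 by rewrite divr_gt0.
near=> B'.
have B'0 : 0 < B' by near: B'; exact: lt_nbhsr.
have [u01 umax] := field_maxP B'0.
rewrite distrC; apply: stable => //.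
have BB : `|B - B'| < eta / 2 by near: B'; exact: cvgr_dist_lt.
have := p_fun_field_lipschitz B B' s; have := p_fun_field_lipschitz B B' (field_max B').
rewrite !ler_norml => /andP[h1 _] /andP[_ h2].
have := umax s s01.
by lra.
Unshelve. all: by end_near. Qed.

(** Testing [s] at [B'] bounds the increment below with a fixed slope; testing [field_max B'] at [B]
    bounds it above with a moving slope, which converges because [field_max] does. *)
Lemma is_derive_pressure (phi : R -> R) :
  (forall B' u, 0 < B' -> p_maximizers W q beta B' u -> phi B' = p_fun W q beta B' u) ->
  is_derive B 1 phi (spin1_mean B s).
Proof.
move=> phiE.
apply: (@is_derive_squeeze _ phi (fun B' => spin1_mean B' (field_max B'))).
  near=> B'.
  have B'0 : 0 < B' by near: B'; exact: lt_nbhsr.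
  have uP := field_maxP B'0; have [u01 umax] := uP; have [s01 smax] := s_max.
  rewrite (phiE _ _ B'0 uP) (phiE _ _ B_gt0 s_max).
  have := p_fun_field_tangent B B' s; have := umax s s01.
  have := p_fun_field_tangent B' B (field_max B'); have := smax _ u01.
  by lra.
apply/cvgrPdist_le => e e0.
have m0 : 0 < m by [].
have bm0 : 0 < b * m by rewrite mulr_gt0.
have e2 : 0 < e / 2 by rewrite divr_gt0.
have e3 : 0 < e / 2 / (b * m) by rewrite divr_gt0.
near=> B'; apply: le_trans (spin1_mean_lipschitz _ _ _ _) _.
have h1 : `|B - B'| <= e / 2 by near: B'; exact: cvgr_dist_le.
have h2 : `|s - field_max B'| <= e / 2 / (b * m).
  by near: B'; move/cvgrPdist_le : field_max_cvg; exact.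
by rewrite [leRHS](splitr e) lerD// mulrC -ler_pdivlMr.
Unshelve. all: by end_near. Qed.

(** An optimizer exists, so [get] returns one; divided by [E W] it is a global maximizer of the
    rescaled functional, hence the profile of [s]. *)
Lemma x1_starE : x1_star W k1 beta B = spin1_mean B s.
Proof.
have m0 : 0 < m by [].
set y := potts_optimizer W k1 beta B.
have ymax : forall z, potts_functional W k1 beta B z <= potts_functional W k1 beta B y.
  apply: (@getPex _ [set y | forall z, potts_functional W k1 beta B z <=
    potts_functional W k1 beta B y]).
  have [z0 z0max] := mean_field_global_max hq W2 W_ge0 W_gt0 B beta_gt0.
  exists (\row_k (m * z0 k)) => z; rewrite !potts_functionalE//.
  have -> : (fun k => (\row_k (m * z0 k)) 0 k / mean PW W) = z0.
    by apply/funext => k; rewrite mxE mulrC mulKf// gt_eqF.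
  exact: z0max.
pose z k := y 0 k / m.
have zmax z' : mean_field_functional k1 W beta B z' <= mean_field_functional k1 W beta B z.
  have := ymax (\row_k (m * z' k)); rewrite !potts_functionalE//.
  have -> // : (fun k => (\row_k (m * z' k)) 0 k / mean PW W) = z'.
  by apply/funext => k; rewrite mxE mulrC mulKf// gt_eqF.
have [u [uP zu _]] := maximizer_is_profile W2 W_ge0 W_gt0 beta_gt0 B_gt0 zmax.
have us := s_uniq uP.
rewrite /x1_star -/y; apply: eq_mean => x.
have -> : b * s * W x = b * W x * s by ring.
rewrite -(gibbs_profile hq) -us -zu gibbsE [in RHS](bigD1 k1)//=.
have e1 : expR (scaled_exp W beta (y 0 k1) x + B) = expR (mean_field k1 b B z (W x) k1).
  by congr expR; rewrite /mean_field /field1 eqxx /scaled_exp /z -/b -/m; ring.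
rewrite e1; congr (_ / (_ + _)); apply: eq_bigr => k /negbTE kk; congr expR.
by rewrite /mean_field /field1 kk /scaled_exp /z -/b -/m; ring.
Qed.

End FieldDerivative.
Arguments spin1_mean {R} q {dW TW PW} W beta B s.

(** * From the limiting pressure to the finite-volume proportions *)

Section Magnetization.
Context {R : realType} {q : nat} (k1 : 'I_q).
Variable w : forall n : nat, 'I_n -> R.
Arguments w : clear implicits.
Context {d : nat -> measure_display} {T : forall n, measurableType (d n)}.
Variables (P : forall n, probability (T n) R).
Variable I : forall n, 'I_n -> 'I_n -> {RV (P n) >-> bool}.
Hypothesis w_gt0 : forall n (i : 'I_n), 0 < w n i.
Hypothesis graph : forall n, rank1_graph (w n) (@I n).
Variable beta : R.
Hypothesis beta_gt0 : 0 < beta.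

Definition spin1_proportion (n : nat) (B : R) : R :=
  potts_mean k1 (@I n) beta B (@proportion1 R q k1 n).

(** The energies at the two fields differ by [B' - B] times the number of spins 1, whose Gibbs mean
    is therefore the slope in [lse_tangent]. *)
Lemma finite_pressure_tangent n B B' : (0 < n)%N ->
  finite_pressure k1 I beta n B + (B' - B) * spin1_proportion n B <=
  finite_pressure k1 I beta n B'.
Proof.
move=> n0; pose en B := energy k1 (w n) (beta' beta) B.
have ZE C : annealed_partition k1 (@I n) beta C = \sum_s expR (en C s).
  exact: (partitionE k1 w_gt0 graph beta_gt0 C n0).
have -> : spin1_proportion n B = n%:R^-1 *
    \sum_s gibbs (en B) s * \sum_i (s i == k1)%:R.
  rewrite /spin1_proportion /potts_mean mulr_sumr; apply: eq_bigr => s _.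
  rewrite /annealed_potts /proportion1 ZE gibbsE.
  by rewrite (annealed_weight_energy k1 w_gt0 graph beta_gt0 B s n0) mulrCA.
rewrite /finite_pressure !ZE mulrCA -mulrDr ler_wpM2l ?invr_ge0//.
apply: le_trans (lse_tangent [ffun=> k1] (en B) (en B')).
rewrite lerD2l mulr_sumr le_eqVlt; apply/orP; left; apply/eqP.
apply: eq_bigr => s _; rewrite mulrCA; congr *%R.
rewrite /en /energy opprD addrACA subrr addr0 -sumrB mulr_sumr.
apply: eq_bigr => i _; rewrite /field1.
by case: eqP => _; rewrite ?mulr1 ?mulr0 ?subrr.
Qed.

(* The finite pressures are convex in the field and have the proportion of spins 1 as
   derivative, hence these derivatives converge wherever the limit is derivable. *)
Lemma spin1_proportion_cvg (phi : R -> R) (B l : R) :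
  (\forall B' \near B, finite_pressure k1 I beta n B' @[n --> \oo] --> phi B') ->
  is_derive B 1 phi l -> spin1_proportion n B @[n --> \oo] --> l.
Proof.
move=> cphi [dphi <-].
apply/cvgrPdist_le => e e0; set dl := 'D_1 phi B.
have e2 : 0 < e / 2 by rewrite divr_gt0.
have quot : \forall h \near (0 : R)^', `|dl - h^-1 * (phi (h + B) - phi B)| <= e / 2.
  have /cvgrPdist_le /(_ _ e2) := dphi; apply: filterS => h.
  by rewrite /GRing.scale/= mulr1.
have cphiB : finite_pressure k1 I beta n B @[n --> \oo] --> phi B by exact: nbhs_singleton cphi.
have [h [h0 [qp qm] [cp cm]]] : exists h : R, [/\ 0 < h,
    `|dl - h^-1 * (phi (h + B) - phi B)| <= e / 2 /\
    `|dl - (- h)^-1 * (phi (- h + B) - phi B)| <= e / 2 &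
    finite_pressure k1 I beta n (h + B) @[n --> \oo] --> phi (h + B) /\
    finite_pressure k1 I beta n (- h + B) @[n --> \oo] --> phi (- h + B)].
  have [r1 /= r10 H1] := quot.
  have [r2 /= r20 H2] := cphi.
  pose h := Num.min r1 r2 / 2.
  have mr : 0 < Num.min r1 r2 by rewrite lt_min r10.
  have h0 : 0 < h by rewrite divr_gt0.
  have hr1 : h < r1.
    by rewrite (lt_le_trans (_ : h < Num.min r1 r2))// ?ge_min ?lexx// /h; lra.
  have hr2 : h < r2.
    by rewrite (lt_le_trans (_ : h < Num.min r1 r2))// ?ge_min ?lexx ?orbT// /h; lra.
  have hn : `|h| = h by rewrite gtr0_norm.
  exists h; split => //; split.
  - by apply: H1; rewrite /= ?sub0r ?normrN ?hn// gt_eqF.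
  - by apply: H1; rewrite /= ?sub0r ?opprK ?normrN ?hn// oppr_eq0 gt_eqF.
  - by apply: H2; rewrite /= opprD addrCA subrr addr0 normrN hn.
  - by apply: H2; rewrite /= opprD opprK addrCA subrr addr0 hn.
have eh : 0 < e * h / 4 by rewrite divr_gt0// mulr_gt0.
near=> n.
have n0 : (0 < n)%N by near: n; exact: nbhs_infty_gt.
have a0 : `|phi B - finite_pressure k1 I beta n B| <= e * h / 4.
  by near: n; move/cvgrPdist_le : cphiB; exact.
have a1 : `|phi (h + B) - finite_pressure k1 I beta n (h + B)| <= e * h / 4.
  by near: n; move/cvgrPdist_le : cp; exact.
have a2 : `|phi (- h + B) - finite_pressure k1 I beta n (- h + B)| <= e * h / 4.
  by near: n; move/cvgrPdist_le : cm; exact.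
have t1 := finite_pressure_tangent B (h + B) n0.
have t2 := finite_pressure_tangent B (- h + B) n0.
rewrite !addrK in t1 t2.
set p := spin1_proportion n B in t1 t2 *.
have up : p <= h^-1 * (phi (h + B) - phi B) + e / 2.
  rewrite -(ler_pM2l h0) mulrDr mulrA mulfV ?gt_eqF// mul1r.
  by move: a0 a1; rewrite !ler_norml => /andP[? ?] /andP[? ?]; lra.
have dn : (- h)^-1 * (phi (- h + B) - phi B) - e / 2 <= p.
  rewrite -(ler_pM2l h0) invrN mulNr mulrBr mulrN mulrA mulfV ?gt_eqF// mul1r.
  by move: a0 a2; rewrite !ler_norml => /andP[? ?] /andP[? ?]; lra.
by move: qp qm; rewrite !ler_norml => /andP[? ?] /andP[? ?]; apply/andP; split; lra.
Unshelve. all: by end_near. Qed.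

End Magnetization.

Theorem theorem1p12 (R : realType)
    (* the weights and, for each n, the random graph on 'I_n *)
    (w : forall n : nat, 'I_n -> R)
    (d : nat -> measure_display) (T : forall n, measurableType (d n))
    (P : forall n, probability (T n) R)
    (I : forall n, 'I_n -> 'I_n -> {RV (P n) >-> bool})
    (* the limiting weight *)
    (dW : measure_display) (TW : measurableType dW) (PW : probability TW R)
    (W : {RV PW >-> R})
    (q : nat) (hq : (2 < q)%N) (beta B : R) :
  (forall n (i : 'I_n), 0 < w n i) ->
  (forall n, rank1_graph (w n) (@I n)) ->
  weight_regularity w W ->
  ('E_PW[(fun omega => W omega ^+ 2)%R] < +oo)%E ->
  0 < B -> B < ln (q%:R - 1) ->
  zero_crossing W q B ->
  0 < beta -> beta != critical_beta W q B ->
  let phi := annealed_pressure (spin1 hq) I beta in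
  [/\ derivable phi B 1,
      potts_mean (spin1 hq) (@I n) beta B (@proportion1 R q (spin1 hq) n)
        @[n --> \oo] --> derive1 phi B &
      derive1 phi B = x1_star W (spin1 hq) beta B].
Proof.
move=> w_gt0 graph wreg W2 B_gt0 Blt zc beta_gt0 beta_nc phi.
have W_ge0 := weight_ge0 w_gt0 wreg.
have W_gt0 : 0 < mean PW W.
  have [EW _ _] := wreg.
  rewrite -lte_fin fineK//.
  have := integrable_fin_num measurableT (has_mean_weight W2).
  by rewrite unlock.
(* Stated for every positive field: the derivative at [B] needs the values of the pressure around
   [B], where several maximizers may coexist. They share the same value of [p_fun]. *)
have cvg_pressure B' u : 0 < B' -> p_maximizers W q beta B' u ->
    finite_pressure (spin1 hq) I beta n B' @[n --> \oo] --> p_fun W q beta B' u.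
  move=> B'0 up; rewrite (p_funE hq W2 beta_gt0).
  apply: (finite_pressure_cvg w_gt0 graph wreg W2 beta_gt0) => z _.
  by rewrite -(p_funE hq W2 beta_gt0); exact: (p_maximizer_global hq W2 W_ge0 W_gt0).
have phiE B' u : 0 < B' -> p_maximizers W q beta B' u -> phi B' = p_fun W q beta B' u.
  by move=> B'0 up; apply/cvg_lim => //; exact: cvg_pressure.
have [s sP] := p_maximizers_nonempty hq W2 W_ge0 W_gt0 beta_gt0 B_gt0.
have s_uniq u : p_maximizers W q beta B u -> u = s.
  by move=> uP; exact: (p_maximizer_unique hq W2 W_ge0 W_gt0 B_gt0 zc beta_gt0 beta_nc).
have dphi : is_derive B 1 phi (spin1_mean q W beta B s).
  exact: (is_derive_pressure hq W2 W_ge0 W_gt0 beta_gt0 B_gt0 sP s_uniq phiE).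
have phi1 : derive1 phi B = spin1_mean q W beta B s.
  by rewrite derive1E; exact: derive_val.
split.
- by case: dphi.
- rewrite phi1; apply: (spin1_proportion_cvg w_gt0 graph beta_gt0 _ dphi).
  near=> B'; have B'0 : 0 < B' by near: B'; exact: lt_nbhsr.
  have [u up] := p_maximizers_nonempty hq W2 W_ge0 W_gt0 beta_gt0 B'0.
  by rewrite (phiE _ _ B'0 up); exact: cvg_pressure.
- by rewrite phi1 (x1_starE hq W2 W_ge0 W_gt0 beta_gt0 B_gt0 s_uniq).
Unshelve. all: by end_near. Qed.
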